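(* Let $(X,d,\nu)$ be a computable metric space, and define $\hat{D}:\subseteq\Sigma^0_1(X)\times\mathcal{K}_{>}(X)\rightrightarrows\Delta^0_1(X)^{\mathbb{N}}\times(\mathbb{Z}^+)^{\mathbb{N}}\times\{0,1\}^{\mathbb{N}}$ with domain $\{(U,K) : U\subseteq K\}$ by declaring $((W_i)_i,r,s)\in\hat{D}(U,K)$ iff $(W_i)_i$ is pairwise disjoint, $\bigcup_iW_i=U\subseteq K$, $(\forall i)(W_i=\emptyset\iff s_i=0)$, and $$(\forall n)(\forall j<r_n)\left(\operatorname{diam}W_{\sum_{i<n}r_i+j}<(n+1)^{-1}\right).$$ Consider the conditions: (1) $X$ is $\delta_{\text{disj-cover}}'$-computable. (2) There exist a basis $\mathcal{B}$ for the topology of $X$ and a computable $b:\mathbb{N}\to\mathcal{KO}$ with $\operatorname{im}b=\mathcal{B}\subseteq\mathcal{KO}$. (3) The operation $\hat{D}$ is computable and there exists a computable $\gamma:\mathbb{N}\to\Sigma^0_1(X)\times\mathcal{K}_{>}(X)$ such that $\mathcal{B}:=\operatorname{im}(\pi_1\circ\gamma)$ is a basis for the topology of $X$ and $(\forall a\in\mathbb{N})(\pi_1\gamma(a)\subseteq\pi_2\gamma(a))$. (4) There exist a computable $b:\mathbb{N}\to\Delta^0_1(X)$ and a c.e. refined inclusion of $b$ with respect to $\alpha$ such that $\mathcal{B}:=\operatorname{im}b$ is a basis for the topology of $X$. Then (1)$\implies$(2)$\iff$(3)$\implies$(4).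
   Context: TTE conventions. $\mathbb{B}=\mathbb{N}^{\mathbb{N}}$, $p_i:=p(i)$. $\langle\cdot\rangle:\mathbb{N}^*\to\mathbb{N}$ (words) and $\langle\cdot,\cdot\rangle:\mathbb{N}^2\to\mathbb{N}$ (pairs) are standard computable tupling bijections, with projections $\pi_1,\pi_2:\mathbb{N}\to\mathbb{N}$ for pairs; $\pi_1,\pi_2$ also denote the projections of a cartesian product. On $\mathbb{B}$: $\langle p^{(0)},p^{(1)}\rangle(2i+z)=p^{(z)}_i$ ($z\in\{0,1\}$) and $\langle p^{(0)},p^{(1)},\dots\rangle(\langle i,j\rangle)=p^{(i)}_j$. A representation of a set is a partial surjection $\delta:\subseteq\mathbb{B}\to X$; a point is $\delta$-computable if it has a computable $\delta$-name. A multi-valued operation $f:\subseteq X\rightrightarrows Y$ assigns to each $x\in\operatorname{dom}f$ a subset $f(x)\subseteq Y$; for representations $\delta,\delta'$ of $X,Y$ it is computable if there is a (Type-2 Turing machine) computable $F:\subseteq\mathbb{B}\to\mathbb{B}$ such that whenever $p\in\operatorname{dom}\delta$ and $\delta(p)\in\operatorname{dom}f$, $F(p)$ is defined, $F(p)\in\operatorname{dom}\delta'$ and $\delta'(F(p))\in f(\delta(p))$. Finite products carry $[\delta_1,\delta_2]\langle p,q\rangle=(\delta_1(p),\delta_2(q))$ (iterated), countable powers $\delta^{\omega}\langle p^{(0)},p^{(1)},\dots\rangle=(\delta(p^{(i)}))_i$, $\mathbb{N}$ carries $\delta_{\mathbb{N}}(p)=p_0$, and subsets of $\mathbb{B}$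 carry the identity. Computable metric space $(X,d,\nu)$: $(X,d)$ is a metric space, $\nu:\mathbb{N}\to X$ is total with dense image, and $(i,j)\mapsto d(\nu(i),\nu(j))$ is a computable double sequence of reals. With $\nu_{\mathbb{Q}^+}$ a standard total numbering of the positive rationals, $\alpha\langle a,r\rangle=B_d(\nu(a);\nu_{\mathbb{Q}^+}(r))$. $\Sigma^0_1(X)$ (open sets) carries $\delta_{\Sigma^0_1}(p)=\bigcup\{\alpha(p_i-1) : p_i\geq1\}$; $\Pi^0_1(X)$ (closed sets) carries $\delta_{\Pi^0_1}(p)=X\setminus\delta_{\Sigma^0_1}(p)$; $\Delta^0_1(X)$ (clopen sets) carries $\delta_{\Delta^0_1}\langle p,q\rangle=W$ whenever $W=\delta_{\Sigma^0_1}(p)=\delta_{\Pi^0_1}(q)$. A word $w\in\mathbb{N}^{*}$ codes the ideal cover $(\alpha(w_i))_{i<|w|}$; $U\langle w\rangle:=\bigcup_{i<|w|}\alpha(w_i)$. $\mathcal{K}(X)$ is the class of compact subsets of $X$ (including $\emptyset$). $\delta_{\text{cover}}$: $p$ is a name of $K\in\mathcal{K}(X)$ iff $\{p_i : i\in\mathbb{N}\}=\{\langle w\rangle : w\in\mathbb{N}^*,K\subseteq U\langle w\rangle\}$. $\mathcal{K}_{>}(X)$ is $\mathcal{K}(X)$ with representation $\delta_{\text{cover}}$. $\mathcal{KO}$ is the class of compact open subsets of $X$, with representation $\delta_{\mathcal{KO}}$: $\langle p,q\rangle$ is a name of $K$ iff $\delta_{\Delta^0_1}(p)=K=\delta_{\text{cover}}(q)$.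 Words $u,v\in\mathbb{N}^*$ are formally disjoint if $d(\nu(\pi_1u_i),\nu(\pi_1v_j))>\nu_{\mathbb{Q}^+}(\pi_2u_i)+\nu_{\mathbb{Q}^+}(\pi_2v_j)$ for all $i<|u|,j<|v|$. $\delta_{\text{disj-cover}}'$ is the representation of $\mathcal{Z}_{\mathrm{c}}(X)=\{K\in\mathcal{K}(X) : \dim K\leq0\}$ ($\dim$ = covering dimension; i.e. $K$ is zero-dimensional or empty) for which $p$ is a name of $K$ iff $\{a\in\mathbb{N} : (\exists i)\,p_i=a+1\}$ equals the set of all $\langle\langle w^{(0)}\rangle,\dots,\langle w^{(l-1)}\rangle\rangle$ (word coding applied to the word of codes) with $l\in\mathbb{N}$, $w^{(0)},\dots,w^{(l-1)}\in\mathbb{N}^*$ pairwise formally disjoint and $\bigcup_{i<l}U\langle w^{(i)}\rangle\supseteq K$. In particular condition (1) includes that $X$ is compact with $\dim X\leq0$. Refined inclusion: for $b:\mathbb{N}\to\Sigma^0_1(X)$ with image a basis, $\sqsubset'\subseteq\mathbb{N}^2$ is a refined inclusion of $b$ with respect to $\alpha$ if (a) $m\sqsubset' n\implies b(m)\subseteq\alpha(n)$, and (b) for all $n$ and $x\in\alpha(n)$ there is $m$ with $x\in b(m)$ and $m\sqsubset' n$. *)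

(* Defs.v *)
From Stdlib Require Cantor.
From mathcomp Require Import all_boot all_order all_algebra.
From mathcomp Require Import all_classical all_reals all_analysis.

Set Implicit Arguments.
Unset Strict Implicit.
Unset Printing Implicit Defensive.

Import Order.TTheory GRing.Theory Num.Theory.

Local Open Scope classical_set_scope.
Local Open Scope nat_scope.

Definition baire : Type := nat -> nat.

(** Type-2 computable [F : ⊆ baire -> baire] are exactly the functions for which
    [F p n] is computed, uniformly in the oracle [p], by an oracle program;
    programs are Kleene's schemes (partial recursive functions) with an extra
    primitive querying the oracle. Argument lists are untyped: missing
    arguments read as 0. *)

Inductive prog : Type :=
| PZero
| PSucc
| PProj of nat
| POracle
| PComp of prog & seq prog
| PRec of prog & prog
| PMu of prog.

(** [runs p c v r]: with oracle [p], program [c] halts on arguments [v] with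
    value [r]. In [PRec f g] the recursion argument is the first one, and [g]
    receives the counter, the previous value and the parameters. *)
Inductive runs (p : baire) : prog -> seq nat -> nat -> Prop :=
| EvZero v : runs p PZero v 0
| EvSucc v : runs p PSucc v (nth 0 v 0).+1
| EvProj i v : runs p (PProj i) v (nth 0 v i)
| EvOracle v : runs p POracle v (p (nth 0 v 0))
| EvComp f gs v ws r :
    runs_seq p gs v ws -> runs p f ws r -> runs p (PComp f gs) v r
| EvRec0 f g v r : runs p f v r -> runs p (PRec f g) (0 :: v) r
| EvRecS f g n v s r :
    runs p (PRec f g) (n :: v) s -> runs p g [:: n, s & v] r ->
    runs p (PRec f g) (n.+1 :: v) r
| EvMu f v n (h : nat -> nat) :
    (forall m, m < n -> runs p f (m :: v) (h m).+1) ->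
    runs p f (n :: v) 0 -> runs p (PMu f) v n
with runs_seq (p : baire) : seq prog -> seq nat -> seq nat -> Prop :=
| EvNil v : runs_seq p [::] v [::]
| EvCons g gs v w ws :
    runs p g v w -> runs_seq p gs v ws -> runs_seq p (g :: gs) v (w :: ws).

(** [runs] is deterministic, so this is the graph of a partial function; it is
    defined at [p] iff [c] with oracle [p] halts on every single argument. *)
Definition type2_graph (c : prog) (p q : baire) : Prop :=
  forall n, runs p c [:: n] (q n).

(** The constant oracle provides no information. *)
Definition no_oracle : baire := fun=> 0.

Definition computable_baire (p : baire) : Prop :=
  exists c, forall n, runs no_oracle c [:: n] (p n).

Definition ce_rel (S : nat -> nat -> Prop) : Prop :=
  exists c, forall m n, S m n <-> exists r, runs no_oracle c [:: m; n] r.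

Definition pairN (i j : nat) : nat := Cantor.to_nat (i, j).
Definition pr1 (n : nat) : nat := (Cantor.of_nat n).1.
Definition pr2 (n : nat) : nat := (Cantor.of_nat n).2.
Definition wcode : seq nat -> nat := CodeSeq.code.

Definition unpair_l (p : baire) : baire := fun i => p (2 * i).
Definition unpair_r (p : baire) : baire := fun i => p (2 * i + 1).
Definition untuple (p : baire) (i : nat) : baire := fun j => p (pairN i j).

(** A representation is given by the graph of the partial surjection:
    [delta p x] means that [p] is a [delta]-name of [x]. Represented sets of
    subsets of a space are carried by the full type [set T], the elements of
    the represented set being those that have a name. *)

Definition rep (X : Type) : Type := baire -> X -> Prop.

Definition rep_nat : rep nat := fun p n => p 0 = n.

Definition rep_id (A : set baire) : rep baire := fun p q => A p /\ q = p.

Definition rep_prod (X Y : Type) (dX : rep X) (dY : rep Y) : rep (X * Y) :=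
  fun p xy => dX (unpair_l p) xy.1 /\ dY (unpair_r p) xy.2.

Definition rep_pow (X : Type) (dX : rep X) : rep (nat -> X) :=
  fun p x => forall i, dX (untuple p i) (x i).

Definition computable_point (X : Type) (dX : rep X) (x : X) : Prop :=
  exists p, computable_baire p /\ dX p x.

(** [f] is the multi-valued operation with domain [D]; [f x] is irrelevant for
    [x] outside [D]. *)
Definition computable_op (X Y : Type) (dX : rep X) (dY : rep Y)
    (D : set X) (f : X -> set Y) : Prop :=
  exists c, forall p x, dX p x -> D x ->
    exists q, type2_graph c p q /\ exists y, dY q y /\ f x y.

Definition computable_fun (X Y : Type) (dX : rep X) (dY : rep Y)
    (f : X -> Y) : Prop :=
  computable_op dX dY setT (fun x => [set f x]).

Local Open Scope ring_scope.

(** Total numberings of the rationals and of the positive rationals: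
    <<a,b>,c> |-> (a - b) / (c + 1) and <a,b> |-> (a + 1) / (b + 1). *)
Definition nuQ (n : nat) : rat :=
  ((pr1 (pr1 n))%:R - (pr2 (pr1 n))%:R) / (pr2 n).+1%:R.

Definition nuQpos (n : nat) : rat := (pr1 n).+1%:R / (pr2 n).+1%:R.

Definition computable_real_double_seq (R : realType) (u : nat -> nat -> R) :
    Prop :=
  exists f : baire, computable_baire f /\
    forall i j k,
      `|u i j - ratr (nuQ (f (pairN i (pairN j k))))| <= (2 ^+ k)^-1.

Definition computable_metric_space (R : realType) (T : metricType R)
    (nu : nat -> T) : Prop :=
  dense (range nu) /\
  computable_real_double_seq (fun i j => mdist (nu i) (nu j)).

Section Metric.
Context {R : realType} {T : metricType R}.
Implicit Types (A K U W : set T) (p q : baire).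

(** With [diam set0 = 0], and [+oo] for unbounded sets. *)
Definition diam A : \bar R :=
  ereal_sup ([set 0%E] `|` [set (mdist xy.1 xy.2)%:E | xy in A `*` A]).

(** Covering dimension of the subspace [K]: every finite open cover of [K] has
    a finite refinement by relatively open sets such that no point lies in more
    than [n + 1] members. In particular [covdim_le set0 n] holds. *)
Definition covdim_le K (n : nat) : Prop :=
  forall (k : nat) (O : 'I_k -> set T),
    (forall i, open (O i)) -> K `<=` \bigcup_i O i ->
    exists (l : nat) (V : 'I_l -> set T),
      [/\ forall j, exists2 G, open G & V j = K `&` G,
          K `<=` \bigcup_j V j,
          forall j, exists i, V j `<=` O i &
          forall J : {set 'I_l}, (n.+1 < #|J|)%N ->
            \bigcap_(j in [set` J]) V j = set0].

Variable nu : nat -> T.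

Definition alpha (n : nat) : set T := ball (nu (pr1 n)) (ratr (nuQpos (pr2 n))).

Definition delta_Sigma : rep (set T) := fun p U =>
  U = \bigcup_(i in [set i | (0 < p i)%N]) alpha (p i).-1.

Definition delta_Pi : rep (set T) := fun p A =>
  exists U, delta_Sigma p U /\ A = ~` U.

Definition delta_Delta : rep (set T) := fun p W =>
  delta_Sigma (unpair_l p) W /\ delta_Pi (unpair_r p) W.

Definition ideal_cover (w : seq nat) : set T := \bigcup_(a in [set` w]) alpha a.

Definition delta_cover : rep (set T) := fun p K =>
  compact K /\ range p = [set wcode w | w in [set w | K `<=` ideal_cover w]].

Definition KO : set (set T) := [set K | compact K /\ open K].

Definition delta_KO : rep (set T) := fun p K =>
  KO K /\ delta_Delta (unpair_l p) K /\ delta_cover (unpair_r p) K.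

Definition formally_disjoint (u v : seq nat) : bool :=
  allrel (fun a b => mdist (nu (pr1 a)) (nu (pr1 b)) >
                     ratr (nuQpos (pr2 a)) + ratr (nuQpos (pr2 b))) u v.

Definition Zc : set (set T) := [set K | compact K /\ covdim_le K 0].

Definition delta_disj_cover' : rep (set T) := fun p K =>
  Zc K /\
  [set a | exists i, p i = a.+1] =
  [set wcode (map wcode ws) | ws in
     [set ws | pairwise formally_disjoint ws /\
               K `<=` \bigcup_(w in [set` ws]) ideal_cover w]].

Definition refined_inclusion (b : nat -> set T) (S : nat -> nat -> Prop) : Prop :=
  (forall m n, S m n -> b m `<=` alpha n) /\
  (forall n x, alpha n x -> exists m, b m x /\ S m n).

Definition Dhat_dom : set (set T * set T) := [set UK | UK.1 `<=` UK.2].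

Definition Dhat (UK : set T * set T) : set ((nat -> set T) * baire * baire) :=
  [set Wrs | let: (W, r, s) := Wrs in
    [/\ trivIset setT W,
        \bigcup_i W i = UK.1,
        UK.1 `<=` UK.2,
        forall i, W i = set0 <-> s i = 0%N &
        forall n j : nat, (j < r n)%N ->
          (diam (W (\sum_(i < n) r i + j)%N) < (n.+1%:R^-1)%:E)%E]].

Definition Dhat_computable : Prop :=
  computable_op
    (rep_prod delta_Sigma delta_cover)
    (rep_prod
       (rep_prod (rep_pow delta_Delta)
                 (rep_id [set r | forall n, (0 < r n)%N]))
       (rep_id [set s | forall n, (s n < 2)%N]))
    Dhat_dom Dhat.

End Metric.

(* Main.v *)
Require Import Defs.
From Stdlib Require Cantor.
From mathcomp Require Import all_boot all_order all_algebra.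
From mathcomp Require Import all_classical all_reals all_analysis.
From mathcomp Require Import zify ring lra.

(** The combinatorial content is carried by relations that are semidecidable
    relative to an oracle, which are closed under conjunction,
    disjunction, existential and bounded universal quantification, and admit
    effective choice. Only names are then needed in this form: an open set is a
    semidecidable union of ideal balls, and for a compact [K] the words covering
    it form a semidecidable set.

    (1) => (2). The pieces of the formally disjoint tuples covering [X] are
    clopen, the complement of a piece being the union of the other pieces of
    its tuple; and [w] covers [X] iff some enumerated tuple consists of balls
    formally included in balls of [w].

    (2) => (3). Given [U], enumerate basis elements exhausting [U], cover the
    [n]-th one by finitely many basis elements inside [U] of diameter less than
    [1/(n+1)], concatenate these lists into [c_0, c_1, ...], and let [W_i] be
    [b(c_i)] minus the previous [b(c_j)]. Emptiness of [W_i] is decidable: being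
    covered by the empty word and containing an ideal ball are both
    semidecidable.

    (3) => (2). The sets [W_i] produced from all [gamma a] form a basis, and a
    word covers [W_i] iff some cover of the compact set [pi_2 (gamma a)] uses
    only its balls and balls avoiding [W_i].

    (2) => (4). [b m <= alpha n] is semidecidable and is a refined inclusion. *)

Set Implicit Arguments.
Unset Strict Implicit.
Unset Printing Implicit Defensive.

Import Order.TTheory GRing.Theory Num.Theory.

Local Open Scope classical_set_scope.
Local Open Scope nat_scope.

(** * Oracle programs *)

Lemma pr1_pairN i j : pr1 (pairN i j) = i.
Proof. by rewrite /pr1 /pairN Cantor.cancel_of_to. Qed.

Lemma pr2_pairN i j : pr2 (pairN i j) = j.
Proof. by rewrite /pr2 /pairN Cantor.cancel_of_to. Qed.

Lemma pairN_pr n : pairN (pr1 n) (pr2 n) = n.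
Proof.
by rewrite /pr1 /pr2 /pairN -surjective_pairing Cantor.cancel_to_of.
Qed.

Definition prE := (pr1_pairN, pr2_pairN).

(** Triangular numbers; they put the Cantor pairing in a closed form that programs can evaluate. *)
Fixpoint triangle (n : nat) : nat := if n is m.+1 then n + triangle m else 0.

Lemma pairNE i j : pairN i j = j + triangle (i + j).
Proof.
rewrite [(i + j)%N]addnC /pairN /Cantor.to_nat !plusE; congr (_ + _).
by elim: (j + i) => //= n ->.
Qed.

Section Programs.
Implicit Types (p : baire) (v : seq nat).

Lemma runs1 p f g v a r :
  runs p g v a -> runs p f [:: a] r -> runs p (PComp f [:: g]) v r.
Proof. by move=> h; apply: EvComp; do ?[apply: EvCons h _|constructor]. Qed.

Lemma runs2 p f g h v a b r :
  runs p g v a -> runs p h v b -> runs p f [:: a; b] r ->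
  runs p (PComp f [:: g; h]) v r.
Proof. by move=> ? ?; apply: EvComp; do !constructor. Qed.

Lemma runs_proj p i v r : r = nth 0 v i -> runs p (PProj i) v r.
Proof. by move=> ->; constructor. Qed.

Definition psuccof (i : nat) : prog := PComp PSucc [:: PProj i].

Lemma runs_succof p i v : runs p (psuccof i) v (nth 0 v i).+1.
Proof. by apply: runs1; constructor. Qed.

Definition padd : prog := PRec (PProj 0) (psuccof 1).

Lemma runs_add p a b v : runs p padd (a :: b :: v) (a + b).
Proof.
elim: a => [|a IHa]; first by apply/EvRec0/runs_proj.
by apply: EvRecS IHa _; exact: runs_succof.
Qed.

Definition pmul : prog := PRec PZero (PComp padd [:: PProj 2; PProj 1]).

Lemma runs_mul p a b v : runs p pmul (a :: b :: v) (a * b).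
Proof.
elim: a => [|a IHa]; first by apply/EvRec0; constructor.
apply: EvRecS IHa _; rewrite mulSn.
by apply: runs2; [exact: runs_proj| exact: runs_proj| exact: runs_add].
Qed.

Definition ppred : prog := PRec PZero (PProj 0).

Lemma runs_pred p a v : runs p ppred (a :: v) a.-1.
Proof.
elim: a => [|a IHa]; first by apply/EvRec0; constructor.
by apply: EvRecS IHa _; exact: runs_proj.
Qed.

(** Truncated subtraction with the subtrahend first, because [PRec] recurses on its first
    argument. *)
Definition prsub : prog := PRec (PProj 0) (PComp ppred [:: PProj 1]).

Lemma runs_rsub p a b v : runs p prsub (a :: b :: v) (b - a).
Proof.
elim: a => [|a IHa]; first by apply: EvRec0; apply: runs_proj; rewrite subn0.
apply: EvRecS IHa _; rewrite subnS.
by apply: runs1; [exact: runs_proj| exact: runs_pred].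
Qed.

Definition ptri : prog :=
  PRec PZero (PComp padd [:: psuccof 0; PProj 1]).

Lemma runs_tri p a v : runs p ptri (a :: v) (triangle a).
Proof.
elim: a => [|a IHa]; first by apply/EvRec0; constructor.
apply: EvRecS IHa _.
by apply: runs2; [exact: runs_succof| exact: runs_proj| exact: runs_add].
Qed.

Definition ppair : prog :=
  PComp padd [:: PProj 1; PComp ptri [:: PComp padd [:: PProj 0; PProj 1]]].

Lemma runs_pair p a b v : runs p ppair (a :: b :: v) (pairN a b).
Proof.
rewrite pairNE; apply: runs2; [exact: runs_proj| | exact: runs_add].
apply: runs1; last exact: runs_tri.
by apply: runs2; [exact: runs_proj| exact: runs_proj| exact: runs_add].
Qed.

(** Finds the index [s] of the antidiagonal of [n], the least [s] with
    [n < triangle s.+1]. *)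
Definition pdiag : prog :=
  PMu (PComp prsub [:: PComp ptri [:: psuccof 0]; psuccof 1]).

Lemma triangle_mono a b : a <= b -> triangle a <= triangle b.
Proof.
elim: b => [|b IHb]; first by rewrite leqn0 => /eqP->.
by rewrite leq_eqVlt => /predU1P[->//|/IHb]; rewrite /=; lia.
Qed.

Lemma runs_diag p a v : runs p pdiag (a :: v) (pr1 a + pr2 a).
Proof.
set s := pr1 a + pr2 a.
have aE : a = pr2 a + triangle s by rewrite -[LHS]pairN_pr pairNE.
have step m : runs p (PComp prsub [:: PComp ptri [:: psuccof 0]; psuccof 1])
    (m :: a :: v) (a.+1 - triangle m.+1).
  apply: runs2; [| exact: runs_succof| exact: runs_rsub].
  by apply: runs1; [exact: runs_succof| exact: runs_tri].
apply: (@EvMu _ _ _ _ (fun m => (a.+1 - triangle m.+1).-1)) => [m ms|].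
  have lt0 : 0 < a.+1 - triangle m.+1 by have := triangle_mono ms; lia.
  by rewrite prednK.
by have := step s; have -> : a.+1 - triangle s.+1 = 0 by rewrite /=; lia.
Qed.

Definition ppr2 : prog := PComp prsub [:: PComp ptri [:: pdiag]; PProj 0].

Lemma runs_pr2 p a v : runs p ppr2 (a :: v) (pr2 a).
Proof.
have -> : pr2 a = a - triangle (pr1 a + pr2 a).
  by rewrite -[X in _ = X - _]pairN_pr pairNE addnK.
apply: runs2; [| exact: runs_proj| exact: runs_rsub].
by apply: runs1; [exact: runs_diag| exact: runs_tri].
Qed.

Definition ppr1 : prog := PComp prsub [:: ppr2; pdiag].

Lemma runs_pr1 p a v : runs p ppr1 (a :: v) (pr1 a).
Proof.
rewrite -[X in runs _ _ _ X](addnK (pr2 a)).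
by apply: runs2; [exact: runs_pr2| exact: runs_diag| exact: runs_rsub].
Qed.

End Programs.

(** * Replacing the oracle by a program *)

Section Substitution.

Definition pshift (i k : nat) : seq prog := [seq PProj j | j <- iota i k].

(** [PRec] needs its counter in front, whereas relayed programs expect the parameter [m] first; the
    step therefore permutes [[:: n, s, m & v]] into [[:: m, n, s & v]]. *)
Definition relay_rec (f h : prog) (k : nat) : prog :=
  PRec f (PComp h [:: PProj 2, PProj 0, PProj 1 & pshift 3 k]).

(** [relay g c k] runs [c] on [k] arguments preceded by a parameter [m], with
    the oracle replaced by [g] run on [m] and the queried position. *)
Fixpoint relay (g c : prog) (k : nat) {struct c} : prog :=
  match c with
  | PZero => PZero
  | PSucc => psuccof 1
  | PProj i => PProj i.+1
  | POracle => PComp g [:: PProj 0; PProj 1]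
  | PComp f gs =>
      PComp (relay g f (size gs)) (PProj 0 :: [seq relay g h k | h <- gs])
  | PRec f h =>
      PComp (relay_rec (relay g f k.-1) (relay g h k.+1) k.-1)
        [:: PProj 1, PProj 0 & pshift 2 k.-1]
  | PMu f => PMu (PComp (relay g f k.+1) [:: PProj 1, PProj 0 & pshift 2 k])
  end.

Scheme runs_mind := Minimality for runs Sort Prop
  with runs_seq_mind := Minimality for runs_seq Sort Prop.

Lemma runs_shift p u v :
  runs_seq p (pshift (size u) (size v)) (u ++ v) v.
Proof.
rewrite /pshift; elim: v u => [|a v IHv] u; first by constructor.
rewrite /=; constructor; first by apply: runs_proj; rewrite nth_cat ltnn subnn.
by have := IHv (rcons u a); rewrite size_rcons cat_rcons.
Qed.

Lemma runs_seq_size p gs v ws : runs_seq p gs v ws -> size ws = size gs.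
Proof.
elim: gs ws => [|g gs IHgs] ws h; inversion h; subst => //=.
by congr _.+1; exact: IHgs.
Qed.

(** Mutual induction on the run with oracle [q]: an oracle query becomes a call of [g], and the
    other schemes only have to pass [m] along. *)
Lemma runs_relay (p q : baire) (g : prog) m c v r :
  (forall i, runs p g [:: m; i] (q i)) -> runs q c v r ->
  runs p (relay g c (size v)) (m :: v) r.
Proof.
move=> gP.
(* [PRec] and [PMu] keep their own argument in first place, where a relayed program has [m]; the two
   are exchanged. *)
have swap a b w f s : runs p f [:: a, b & w] s ->
    runs p (PComp f [:: PProj 1, PProj 0 & pshift 2 (size w)]) [:: b, a & w] s.
  apply: EvComp; do 2![constructor; first exact: runs_proj].
  exact: (@runs_shift p [:: b; a]).
(* The recursion proper is not recoverable from the run of [relay g (PRec f h)],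
   so it is carried along. *)
pose Q c v r := if (c, v) is (PRec f h, n :: w) then
  runs p (relay_rec (relay g f (size w)) (relay g h (size w).+2) (size w))
    [:: n, m & w] r else True.
suff H : runs q c v r -> runs p (relay g c (size v)) (m :: v) r /\ Q c v r.
  by case/H.
move: c v r.
apply: (@runs_mind q
  (fun c v r => runs p (relay g c (size v)) (m :: v) r /\ Q c v r)
  (fun gs v ws => runs_seq p [seq relay g h (size v) | h <- gs] (m :: v) ws)).
- by move=> v; split=> //; constructor.
- by move=> v; split=> //; exact: (@runs_succof p 1 (m :: v)).
- by move=> i v; split=> //; exact: runs_proj.
- by move=> v; split=> //=; apply: runs2 => //; exact: runs_proj.
- move=> f gs v ws r gsv IHgs _ [IHf _]; split=> //=.
  apply: (@EvComp _ _ _ _ (m :: ws)).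
    by constructor; first exact: runs_proj.
  by rewrite -(runs_seq_size gsv).
- move=> f h v r _ [IHf _].
  have rf : Q (PRec f h) (0 :: v) r by exact: EvRec0.
  by split=> //; exact: swap rf.
- move=> f h n v s r _ [_ IHf] _ [IHh _].
  have rf : Q (PRec f h) (n.+1 :: v) r.
    apply: EvRecS IHf _; apply: EvComp IHh.
    do 3![constructor; first exact: runs_proj].
    exact: (@runs_shift p [:: n; s; m]).
  by split=> //; exact: swap rf.
- move=> f v n h _ IHf _ [IHf0 _]; split=> //=.
  apply: (@EvMu _ _ _ _ h) => [i /IHf[IHi _]|]; exact: swap.
- by constructor.
- by move=> g0 gs v w ws _ [] *; constructor.
Qed.

End Substitution.

(** * Computable functionals and semidecidable relations *)

(** Several arguments are passed as one through [pairN]: a binary function [F]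
    is computable when [fun p z => F p (pr1 z) (pr2 z)] is. *)
Definition computable (F : baire -> nat -> nat) : Prop :=
  exists c, forall p n, runs p c [:: n] (F p n).

Notation computable2 F := (computable (fun p z => F p (pr1 z) (pr2 z))).

Section Comp.
Implicit Types (F f g h : baire -> nat -> nat).

Lemma comp_ext F f : (forall p x, F p x = f p x) -> computable F -> computable f.
Proof. by move=> e [c cP]; exists c => p n; rewrite -e. Qed.

Lemma comp_id : computable (fun p x => x).
Proof. by exists (PProj 0) => p n; exact: runs_proj. Qed.

Lemma comp_app F f : computable F -> computable f -> computable (fun p x => F p (f p x)).
Proof.
move=> [c cP] [d dP]; exists (PComp c [:: d]) => p n.
by apply: runs1; [exact: dP| exact: cP].
Qed.

Lemma comp_app_prog c F f :
  (forall p n, runs p c [:: n] (F p n)) -> computable f ->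
  computable (fun p x => F p (f p x)).
Proof. by move=> cP; apply: comp_app; exists c. Qed.

Lemma comp_bin_prog c (F : nat -> nat -> nat) f g :
  (forall p m n, runs p c [:: m; n] (F m n)) -> computable f -> computable g ->
  computable (fun p x => F (f p x) (g p x)).
Proof.
move=> cP [d dP] [e eP]; exists (PComp c [:: d; e]) => p n.
by apply: runs2; [exact: dP| exact: eP| exact: cP].
Qed.

Lemma comp_succ f : computable f -> computable (fun p x => (f p x).+1).
Proof. by apply: (@comp_app_prog PSucc (fun=> succn)) => p n; exact: EvSucc. Qed.

Lemma comp_const k : computable (fun p x => k).
Proof.
elim: k => [|k IHk]; last exact: comp_succ.
by exists PZero => p n; constructor.
Qed.

Lemma comp_oracle f : computable f -> computable (fun p x => p (f p x)).
Proof.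
by apply: (@comp_app_prog POracle (fun p x => p x)) => p n; exact: EvOracle.
Qed.

Lemma comp_pr1 f : computable f -> computable (fun p x => pr1 (f p x)).
Proof. by apply: (@comp_app_prog ppr1 (fun=> pr1)) => *; exact: runs_pr1. Qed.

Lemma comp_pr2 f : computable f -> computable (fun p x => pr2 (f p x)).
Proof. by apply: (@comp_app_prog ppr2 (fun=> pr2)) => *; exact: runs_pr2. Qed.

Lemma comp_pred f : computable f -> computable (fun p x => (f p x).-1).
Proof. by apply: (@comp_app_prog ppred (fun=> predn)) => *; exact: runs_pred. Qed.

Lemma comp_add f g : computable f -> computable g -> computable (fun p x => f p x + g p x).
Proof. by apply: (@comp_bin_prog padd addn) => *; exact: runs_add. Qed.

Lemma comp_mul f g : computable f -> computable g -> computable (fun p x => f p x * g p x).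
Proof. by apply: (@comp_bin_prog pmul muln) => *; exact: runs_mul. Qed.

Lemma comp_sub f g : computable f -> computable g -> computable (fun p x => f p x - g p x).
Proof.
move=> cf cg; apply: (@comp_bin_prog prsub (fun a b => b - a) g f) => // *.
exact: runs_rsub.
Qed.

Lemma comp_pair f g :
  computable f -> computable g -> computable (fun p x => pairN (f p x) (g p x)).
Proof. by apply: (@comp_bin_prog ppair pairN) => *; exact: runs_pair. Qed.

Lemma comp_app2 (F : baire -> nat -> nat -> nat) f g :
  computable2 F -> computable f -> computable g ->
  computable (fun p x => F p (f p x) (g p x)).
Proof.
move=> cF cf cg; apply: comp_ext (comp_app cF (comp_pair cf cg)) => p x.
by rewrite /= !prE.
Qed.

(** The function is given beforehand and its recursion equations are hypotheses; the step reads [x],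
    the counter and the previous value packed as [pairN x (pairN n s)]. *)
Lemma comp_prim (F : baire -> nat -> nat -> nat) f
    (g : baire -> nat -> nat -> nat -> nat) :
  (forall p x, F p x 0 = f p x) ->
  (forall p x n, F p x n.+1 = g p x n (F p x n)) ->
  computable f -> computable (fun p z => g p (pr1 z) (pr1 (pr2 z)) (pr2 (pr2 z))) ->
  computable2 F.
Proof.
move=> F0 FS [cf cfP] [cg cgP].
pose c := PRec cf (PComp cg
  [:: PComp ppair [:: PProj 2; PComp ppair [:: PProj 0; PProj 1]]]).
exists (PComp c [:: ppr2; ppr1]) => p z.
apply: runs2; [exact: runs_pr2| exact: runs_pr1|].
elim: (pr2 z) => [|n IHn]; first by rewrite F0; apply/EvRec0/cfP.
rewrite FS; apply: EvRecS IHn _; apply: runs1.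
  apply: runs2; [exact: runs_proj| | exact: runs_pair].
  by apply: runs2; [exact: runs_proj| exact: runs_proj| exact: runs_pair].
by have := cgP p (pairN (pr1 z) (pairN n (F p (pr1 z) n))); rewrite !prE.
Qed.

Lemma comp_exp2 f : computable f -> computable (fun p x => 2 ^ f p x).
Proof.
have cF : computable2 (fun p x n => 2 ^ n).
  apply: (@comp_prim (fun _ _ n => 2 ^ n) (fun _ _ => 1)
    (fun _ _ _ s => 2 * s)) => [//|p x n| |].
  - exact: expnS.
  - exact: comp_const.
  - cbv beta; apply: comp_mul; first exact: comp_const.
    by do 2!apply: comp_pr2; exact: comp_id.
by move=> cf; exact: (@comp_app2 (fun _ _ n => 2 ^ n) _ _ cF cf cf).
Qed.

Implicit Types (a b : baire -> nat -> bool).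

(** Booleans enter [computable] through the coercion to 0 and 1, so connectives become
    arithmetic. *)
Lemma comp_neg a : computable a -> computable (fun p x => ~~ a p x).
Proof.
by move=> /(comp_sub (comp_const 1)); apply: comp_ext => p x; case: (a p x).
Qed.

Lemma comp_and a b : computable a -> computable b -> computable (fun p x => a p x && b p x).
Proof.
move=> ca cb; apply: comp_ext (comp_mul ca cb) => p x.
by case: (a p x) (b p x) => [] [].
Qed.

Lemma comp_or a b : computable a -> computable b -> computable (fun p x => a p x || b p x).
Proof.
move=> ca cb.
apply: comp_ext (comp_neg (comp_and (comp_neg ca) (comp_neg cb))) => p x.
by case: (a p x) (b p x) => [] [].
Qed.

Lemma comp_leq f g : computable f -> computable g -> computable (fun p x => f p x <= g p x).
Proof.
move=> cf cg; apply: comp_ext (comp_sub (comp_const 1) (comp_sub cf cg)) => p x.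
by rewrite /leq; case: (f p x - g p x).
Qed.

Lemma comp_eq f g : computable f -> computable g -> computable (fun p x => f p x == g p x).
Proof.
move=> cf cg.
by apply: comp_ext (comp_and (comp_leq cf cg) (comp_leq cg cf)) => p x; rewrite eqn_leq.
Qed.

Lemma comp_if b f g : computable b -> computable f -> computable g ->
  computable (fun p x => if b p x then f p x else g p x).
Proof.
move=> cb cf cg.
apply: comp_ext (comp_add (comp_mul cb cf) (comp_mul (comp_neg cb) cg)) => p x.
by case: (b p x); rewrite /=; lia.
Qed.

Lemma comp_all_lt (a : baire -> nat -> nat -> bool) f :
  computable2 a -> computable f -> computable (fun p x => all (a p x) (iota 0 (f p x))).
Proof.
move=> ca cf.
suff cF : computable2 (fun p x n => all (a p x) (iota 0 n)).
  exact: (@comp_app2 (fun p x n => all (a p x) (iota 0 n)) _ _ cF comp_id cf).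
apply: (@comp_prim (fun p x n => all (a p x) (iota 0 n)) (fun _ _ => 1)
  (fun p x n s => s * a p x n)).
- by [].
- by move=> p x n; rewrite -addn1 iotaD all_cat /= andbT add0n mulnb.
- exact: comp_const.
- cbv beta; apply: comp_mul; first by do 2!apply: comp_pr2; exact: comp_id.
  apply: (@comp_app2 a _ _ ca); apply: comp_pr1; first exact: comp_id.
  by apply: comp_pr2; exact: comp_id.
Qed.

Lemma comp_has_lt (a : baire -> nat -> nat -> bool) f :
  computable2 a -> computable f -> computable (fun p x => has (a p x) (iota 0 (f p x))).
Proof.
move=> ca cf; have cn : computable2 (fun p x i => ~~ a p x i) by exact: comp_neg.
apply: comp_ext (comp_neg (comp_all_lt cn cf)) => p x.
by rewrite -[has _ _]negbK -all_predC.
Qed.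

(** The search for a least witness halts everywhere because a witness always exists. [PMu] looks for
    a zero, hence the negated test. *)
Lemma comp_mu (a : baire -> nat -> nat -> bool) :
  computable2 a -> (forall p x, exists y, a p x y) ->
  exists2 f, computable f & forall p x, a p x (f p x).
Proof.
move=> ca aP.
have [c cP] := comp_neg ca.
have /choice[f fP] (px : baire * nat) : exists y, a px.1 px.2 y /\
    forall z, z < y -> ~~ a px.1 px.2 z.
  have e := aP px.1 px.2.
  exists (ex_minn e); case: ex_minnP => y ay ymin; split=> // z.
  by rewrite ltnNge; apply: contra; exact: ymin.
exists (fun p x => f (p, x)); last by move=> p x; have [] := fP (p, x).
exists (PMu (PComp c [:: PComp ppair [:: PProj 1; PProj 0]])) => p x.
have [fx fmin] := fP (p, x).
have step i : runs p (PComp c [:: PComp ppair [:: PProj 1; PProj 0]])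
    [:: i; x] (~~ a p x i).
  apply: runs1; first by apply: runs2;
    [exact: runs_proj| exact: runs_proj| exact: runs_pair].
  by have := cP p (pairN x i); rewrite /= !prE.
apply: (@EvMu _ _ _ _ (fun=> 0)) => [i /fmin /= ai|].
  by have := step i; rewrite ai.
by have := step (f (p, x)); rewrite fx.
Qed.

End Comp.

(** Builds a program along the syntax of the function; the last clauses use computability hypotheses
    of the context. *)
Ltac comp_step :=
  cbv beta;
  lazymatch goal with
  | |- computable (fun p x => x) => exact: comp_id
  | |- computable (fun _ _ => ?k) => exact: (comp_const k)
  | |- computable (fun p x => (@?f p x).+1) => refine (@comp_succ f _)
  | |- computable (fun p x => (@?f p x).-1) => refine (@comp_pred f _)
  | |- computable (fun p x => pr1 (@?f p x)) => refine (@comp_pr1 f _)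
  | |- computable (fun p x => pr2 (@?f p x)) => refine (@comp_pr2 f _)
  | |- computable (fun p x => p (@?f p x)) => refine (@comp_oracle f _)
  | |- computable (fun p x => @?f p x + @?g p x) => refine (@comp_add f g _ _)
  | |- computable (fun p x => @?f p x * @?g p x) => refine (@comp_mul f g _ _)
  | |- computable (fun p x => @?f p x - @?g p x) => refine (@comp_sub f g _ _)
  | |- computable (fun p x => 2 ^ @?f p x) => refine (@comp_exp2 f _)
  | |- computable (fun p x => pairN (@?f p x) (@?g p x)) => refine (@comp_pair f g _ _)
  | |- computable (fun p x => nat_of_bool (@?f p x <= @?g p x)) =>
      refine (@comp_leq f g _ _)
  | |- computable (fun p x => nat_of_bool (@?f p x == @?g p x)) =>
      refine (@comp_eq f g _ _)
  | |- computable (fun p x => nat_of_bool (~~ @?f p x)) => refine (@comp_neg f _)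
  | |- computable (fun p x => nat_of_bool (@?f p x && @?g p x)) =>
      refine (@comp_and f g _ _)
  | |- computable (fun p x => nat_of_bool (@?f p x || @?g p x)) =>
      refine (@comp_or f g _ _)
  | |- computable (fun p x => nat_of_bool (all (@?a p x) (iota 0 (@?f p x)))) =>
      refine (@comp_all_lt a f _ _)
  | |- computable (fun p x => nat_of_bool (has (@?a p x) (iota 0 (@?f p x)))) =>
      refine (@comp_has_lt a f _ _)
  | |- computable (fun p x => if _ then _ else _) => apply: comp_if
  | h : computable (fun p z => nat_of_bool (?F p (pr1 z) (pr2 z)))
    |- computable (fun p x => nat_of_bool (?F p (@?f p x) (@?g p x))) =>
      refine (@comp_app2 (fun p a b => nat_of_bool (F p a b)) f g h _ _)
  | h : computable (fun p z => ?F p (pr1 z) (pr2 z))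
    |- computable (fun p x => ?F p (@?f p x) (@?g p x)) =>
      refine (@comp_app2 F f g h _ _)
  | h : computable (fun p z => ?F (pr1 z) (pr2 z))
    |- computable (fun p x => ?F (@?f p x) (@?g p x)) =>
      refine (@comp_app2 (fun _ => F) f g h _ _)
  | h : computable (fun p x => nat_of_bool (?F p x))
    |- computable (fun p x => nat_of_bool (?F p (@?f p x))) =>
      refine (@comp_app (fun p x => nat_of_bool (F p x)) f h _)
  | h : computable ?F |- computable (fun p x => ?F p (@?f p x)) =>
      refine (@comp_app F f h _)
  | h : computable (fun _ => ?F) |- computable (fun p x => ?F (@?f p x)) =>
      refine (@comp_app (fun _ => F) f h _)
  end.
Ltac comp_auto := repeat comp_step.

(** * Semidecidable relations, uniformly in the oracle *)

Definition sig1 (S : baire -> nat -> Prop) : Prop :=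
  exists2 G : baire -> nat -> nat -> bool, computable2 G &
    forall p x, (S p x <-> exists k, G p x k).

Notation sig2 S := (sig1 (fun p z => S p (pr1 z) (pr2 z))).

Section Sig1.
Implicit Types (S : baire -> nat -> Prop) (f g : baire -> nat -> nat).

Lemma sig1_ext S S' :
  (forall p x, S p x <-> S' p x) -> sig1 S -> sig1 S'.
Proof. by move=> e [G cG SP]; exists G => // p x; rewrite -e SP. Qed.

Lemma sig1_dec (a : baire -> nat -> bool) : computable a -> sig1 (fun p x => a p x).
Proof.
move=> ca; exists (fun p x _ => a p x); first by comp_auto.
by move=> p x; split=> [|[]//]; exists 0.
Qed.

Lemma sig1_eq f g : computable f -> computable g -> sig1 (fun p x => f p x = g p x).
Proof.
move=> cf cg; apply: sig1_ext (sig1_dec (comp_eq cf cg)) => p x.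
by split=> /eqP.
Qed.

Lemma sig1_app S f : sig1 S -> computable f -> sig1 (fun p x => S p (f p x)).
Proof.
move=> [G cG SP] cf; exists (fun p x k => G p (f p x) k).
  by comp_auto.
by move=> p x; exact: SP.
Qed.

Lemma sig1_app2 (S : baire -> nat -> nat -> Prop) f g :
  sig2 S -> computable f -> computable g -> sig1 (fun p x => S p (f p x) (g p x)).
Proof.
move=> sS cf cg; apply: sig1_ext (sig1_app sS (comp_pair cf cg)) => p x /=.
by rewrite !prE.
Qed.

Lemma sig1_and S S' :
  sig1 S -> sig1 S' -> sig1 (fun p x => S p x /\ S' p x).
Proof.
move=> [G cG SP] [H cH SP'].
exists (fun p x k => G p x (pr1 k) && H p x (pr2 k)).
  by comp_auto.
move=> p x; rewrite SP SP'; split.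
  by move=> [[i gi] [j hj]]; exists (pairN i j); rewrite !prE gi.
by move=> [k /andP[? ?]]; split; [exists (pr1 k)|exists (pr2 k)].
Qed.

Lemma sig1_or S S' :
  sig1 S -> sig1 S' -> sig1 (fun p x => S p x \/ S' p x).
Proof.
move=> [G cG SP] [H cH SP'].
exists (fun p x k => G p x k || H p x k); first by comp_auto.
move=> p x; rewrite SP SP'; split.
  by case=> -[k kP]; exists k; rewrite kP ?orbT.
by case=> k /orP[] kP; [left|right]; exists k.
Qed.

Lemma sig1_ex (S : baire -> nat -> nat -> Prop) :
  sig2 S -> sig1 (fun p x => exists y, S p x y).
Proof.
move=> [G cG SP]; exists (fun p x k => G p (pairN x (pr1 k)) (pr2 k)).
  by comp_auto.
move=> p x; split.
  move=> [y Sy]; have /(SP p (pairN x y))[k Gk] : S p (pr1 (pairN x y)) (pr2 (pairN x y)).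
    by rewrite !prE.
  by exists (pairN y k); rewrite !prE.
move=> [k Gk]; exists (pr1 k).
by have /(SP) := ex_intro (fun i => is_true (G p _ i)) _ Gk; rewrite !prE.
Qed.

(** Finitely many witnesses have a common bound, and one [k] bounding all the searches is a single
    witness. *)
Lemma sig1_all_lt (S : baire -> nat -> nat -> Prop) f :
  sig2 S -> computable f -> sig1 (fun p x => forall i, i < f p x -> S p x i).
Proof.
move=> [G cG SP] cf.
exists (fun p x k =>
  all (fun i => has (G p (pairN x i)) (iota 0 k)) (iota 0 (f p x))).
  by comp_auto.
move=> p x.
have SP' i : S p x i <-> exists k, G p (pairN x i) k.
  by rewrite -SP// !prE.
split=> [h|[k /allP h] i ilt]; last first.
  by have /h/hasP[j _ Gj] : i \in iota 0 (f p x); [rewrite mem_iota|apply/SP'; exists j].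
suff [k kP] : exists k, forall i, i < f p x -> has (G p (pairN x i)) (iota 0 k).
  by exists k; apply/allP => i; rewrite mem_iota => /kP.
elim: (f p x) h => [|n IHn] h; first by exists 0.
have [i ilt|k kP] := IHn; first by apply: h; rewrite ltnS ltnW.
have /SP'[j Gj] := h n (leqnn _).
exists (maxn k j.+1) => i; rewrite ltnS leq_eqVlt => /predU1P[->|/kP/hasP[l]].
  by apply/hasP; exists j; rewrite ?mem_iota//=; lia.
by rewrite mem_iota => lk Gl; apply/hasP; exists l; rewrite ?mem_iota//=; lia.
Qed.

(** Searches for a value paired with a witness and keeps the value. *)
Lemma sig1_choice (S : baire -> nat -> nat -> Prop) :
  sig2 S -> (forall p x, exists y, S p x y) ->
  exists2 f, computable f & forall p x, S p x (f p x).
Proof.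
move=> [G cG SP] SE.
have [|p x|f cf fP] := @comp_mu (fun p x k => G p (pairN x (pr1 k)) (pr2 k)).
- by comp_auto.
- have [y Sy] := SE p x.
  have /(SP p (pairN x y))[k Gk] : S p (pr1 (pairN x y)) (pr2 (pairN x y)).
    by rewrite !prE.
  by exists (pairN y k); rewrite !prE.
exists (fun p x => pr1 (f p x)) ;first by comp_auto.
move=> p x.
by have /(SP) := ex_intro (fun i => is_true (G p _ i)) _ (fP p x); rewrite !prE.
Qed.

(** Effective choice on the graph can only return the value of the function. *)
Lemma comp_graph (S : baire -> nat -> nat -> Prop) f :
  sig2 S -> (forall p x y, S p x y <-> y = f p x) -> computable f.
Proof.
move=> sS Sf.
have [p x|h ch hP] := sig1_choice sS; first by exists (f p x); apply/Sf.
by apply: comp_ext ch => p x; apply/Sf/hP.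
Qed.

End Sig1.

Ltac sig1_step :=
  cbv beta;
  lazymatch goal with
  | |- computable _ => comp_step
  | |- sig1 (fun p x => is_true (@?f p x)) => refine (@sig1_dec f _)
  | |- sig1 (fun p x => @?f p x = @?g p x :> nat) => refine (@sig1_eq f g _ _)
  | |- sig1 (fun p x => @?f p x /\ @?g p x) => refine (@sig1_and f g _ _)
  | |- sig1 (fun p x => @?f p x \/ @?g p x) => refine (@sig1_or f g _ _)
  | |- sig1 (fun p x => exists y, @?S p x y) => refine (@sig1_ex S _)
  | |- sig1 (fun p x => forall i, is_true (i < @?f p x) -> @?S p x i) =>
      refine (@sig1_all_lt S f _ _)
  | h : sig1 (fun p z => ?F p (pr1 z) (pr2 z))
    |- sig1 (fun p x => ?F p (@?f p x) (@?g p x)) =>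
      refine (@sig1_app2 F f g h _ _)
  | h : sig1 (fun p z => ?F (pr1 z) (pr2 z))
    |- sig1 (fun p x => ?F (@?f p x) (@?g p x)) =>
      refine (@sig1_app2 (fun _ => F) f g h _ _)
  | h : sig1 ?F |- sig1 (fun p x => ?F p (@?f p x)) =>
      refine (@sig1_app F f h _)
  | h : sig1 (fun _ => ?F) |- sig1 (fun p x => ?F (@?f p x)) =>
      refine (@sig1_app (fun _ => F) f h _)
  end.
Ltac sig1_auto := repeat sig1_step.

(** * Codes of words *)

Notation word := CodeSeq.decode.

Section WordCodes.
Implicit Types (f g : baire -> nat -> nat).

Lemma wcode_cons a s : wcode (a :: s) = 2 ^ a * (2 * wcode s).+1.
Proof. by rewrite mul2n. Qed.

Lemma word0 : word 0 = [::]. Proof. by []. Qed.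

Lemma odd_expn2_inj a b m n :
  2 ^ a * (2 * m).+1 = 2 ^ b * (2 * n).+1 -> a = b /\ m = n.
Proof.
elim: a b => [|a IHa] [|b].
- by rewrite !expn0; lia.
- by rewrite expn0 expnS -mulnA; lia.
- by rewrite expn0 expnS -mulnA; lia.
- by rewrite !expnS -!mulnA => e; have [|-> ->] := IHa b; first by lia.
Qed.

(** The graph is decidable: a positive code is uniquely a power of 2 times an odd number, which
    yields the head and the code of the tail. Code 0 is the empty word, for which both default to 0,
    and [pairN 0 0] is 0. *)
Lemma comp_uncons f : computable f ->
  computable (fun p x => pairN (head 0 (word (f p x))) (wcode (behead (word (f p x))))).
Proof.
pose S (p : baire) (x z : nat) := (x == 0) && (z == 0) ||
  (x == 2 ^ pr1 z * (2 * pr2 z).+1).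
have cS : sig2 S by rewrite /S; sig1_auto.
move=> cf; apply: (@comp_app (fun _ x => pairN (head 0 (word x))
  (wcode (behead (word x)))) f) => //.
apply: (@comp_graph S _ cS) => p x z; rewrite /S.
case: x => [|x].
  by rewrite word0 [X in _ || X]eq_sym muln_eq0 expn_eq0 /= orbF; split=> /eqP.
rewrite [(x.+1 == 0) && _]/= orFb -{1}(CodeSeq.decodeK x.+1).
case: (word x.+1) (CodeSeq.decodeK x.+1) => [//|a s] _.
rewrite [CodeSeq.code _]wcode_cons; split=> [/eqP/odd_expn2_inj[-> ->]|->].
  by rewrite pairN_pr.
by rewrite !prE.
Qed.

Lemma comp_head f : computable f -> computable (fun p x => head 0 (word (f p x))).
Proof.
by move/comp_uncons/comp_pr1; apply: comp_ext => p x; rewrite prE.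
Qed.

Lemma comp_behead f : computable f -> computable (fun p x => wcode (behead (word (f p x)))).
Proof.
by move/comp_uncons/comp_pr2; apply: comp_ext => p x; rewrite prE.
Qed.

Lemma comp_drop : computable2 (fun p w n => wcode (drop n (word w))).
Proof.
apply: (@comp_prim (fun p w n => wcode (drop n (word w))) (fun p w => w)
  (fun p w n s => wcode (behead (word s)))) => [p w|p w n| |].
- by rewrite drop0; exact: CodeSeq.decodeK.
- by rewrite /wcode CodeSeq.codeK -drop1 drop_drop add1n.
- by comp_auto.
- by apply: comp_behead; comp_auto.
Qed.

Lemma comp_nth f g :
  computable f -> computable g -> computable (fun p x => nth 0 (word (f p x)) (g p x)).
Proof.
move=> cf cg.
apply: comp_ext (comp_head (@comp_app2
  (fun p w n => wcode (drop n (word w))) f g comp_drop cf cg)) => p x.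
by rewrite /wcode CodeSeq.codeK -nth0 nth_drop addn0.
Qed.

(** The length is the least number of letters whose removal leaves code 0, that of the empty word
    alone. *)
Lemma comp_size f : computable f -> computable (fun p x => size (word (f p x))).
Proof.
pose d w n := wcode (drop n (word w)).
have cd : computable2 (fun p => d) := comp_drop.
have d0 w n : (d w n == 0) = (size (word w) <= n).
  rewrite -subn_eq0 -size_drop /d; case: (drop _ _) => [//|a s].
  by rewrite wcode_cons muln_eq0 expn_eq0.
pose S (p : baire) w n := (d w n == 0) && all (fun i => ~~ (d w i == 0)) (iota 0 n).
have cS : sig2 S by rewrite /S; sig1_auto.
move=> cf; apply: (@comp_app (fun _ w => size (word w)) f) => //.
apply: (@comp_graph S _ cS) => p w n; rewrite /S d0; split=> [/andP[le /allP min]|->].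
  apply/eqP; rewrite eqn_leq le andbT leqNgt; apply/negP => lt.
  have /min : size (word w) \in iota 0 n by rewrite mem_iota.
  by rewrite d0 leqnn.
by rewrite leqnn; apply/allP => i; rewrite mem_iota d0 -ltnNge.
Qed.

Lemma comp_mem f g :
  computable f -> computable g -> computable (fun p x => f p x \in word (g p x)).
Proof.
move=> cf cg; have cs := comp_size cg.
have c : computable (fun p x => has (fun i => nth 0 (word (g p x)) i == f p x)
    (iota 0 (size (word (g p x))))).
  apply: (@comp_has_lt (fun p x i => nth 0 (word (g p x)) i == f p x)) => //.
  apply: comp_eq; last by comp_auto.
  by apply: (@comp_nth (fun p z => g p (pr1 z)) (fun p z => pr2 z)); comp_auto.
apply: comp_ext c => p x; congr nat_of_bool; apply/hasP/(nthP 0) => -[i].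
  by rewrite mem_iota => ? /eqP; exists i.
by move=> ? /eqP; exists i; rewrite ?mem_iota.
Qed.

Lemma sig1_all_word (S : baire -> nat -> nat -> Prop) f :
  sig2 S -> computable f ->
  sig1 (fun p x => forall a, a \in word (f p x) -> S p x a).
Proof.
move=> sS cf; have cs := comp_size cf.
have c : sig1 (fun p x => forall i, i < size (word (f p x)) ->
    S p x (nth 0 (word (f p x)) i)).
  apply: (@sig1_all_lt (fun p x i => S p x (nth 0 (word (f p x)) i))) => //.
  apply: (@sig1_app2 S (fun p z => pr1 z)
    (fun p z => nth 0 (word (f p (pr1 z))) (pr2 z))) => //; first by comp_auto.
  by apply: (@comp_nth (fun p z => f p (pr1 z)) (fun p z => pr2 z)); comp_auto.
apply: sig1_ext c => p x; split=> [h a /(nthP 0)[i ilt <-]|h i ilt]; first exact: h.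
exact/h/mem_nth.
Qed.

End WordCodes.

Ltac word_step :=
  cbv beta;
  lazymatch goal with
  | |- computable (fun p x => nth 0 (word (@?f p x)) (@?g p x)) =>
      refine (@comp_nth f g _ _)
  | |- computable (fun p x => size (word (@?f p x))) => refine (@comp_size f _)
  | |- computable (fun p x => nat_of_bool (@?f p x \in word (@?g p x))) =>
      refine (@comp_mem f g _ _)
  | |- sig1 (fun p x => forall a, is_true (a \in word (@?f p x)) -> @?S p x a) =>
      refine (@sig1_all_word S f _ _)
  | _ => sig1_step
  end.
Ltac effective := repeat word_step.

(** * Interleaved names and substitution of names *)

Section Interleaving.

Lemma comp_half f : computable f -> computable (fun p x => (f p x)./2).
Proof.
pose S (p : baire) x y := (2 * y == x) || ((2 * y).+1 == x).
have cS : sig2 S by rewrite /S; effective.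
move=> cf; apply: (@comp_app (fun _ x => x./2) f) => //.
apply: (@comp_graph S _ cS) => p x y; split=> [/orP[]/eqP<-|->].
- by rewrite mul2n doubleK.
- by rewrite mul2n -uphalfE uphalf_double.
- by have := odd_double_half x; rewrite -mul2n; case: (odd x); rewrite /S; lia.
Qed.

Lemma comp_odd f : computable f -> computable (fun p x => odd (f p x)).
Proof.
move=> cf; have ch := comp_half cf.
have c : computable (fun p x => f p x == (2 * (f p x)./2).+1).
  apply: comp_eq => //; apply: (@comp_succ (fun p x => 2 * (f p x)./2)).
  by apply: (@comp_mul (fun _ _ => 2)) => //; exact: comp_const.
apply: comp_ext c => p x; congr nat_of_bool.
rewrite -{1}(odd_double_half (f p x)) -mul2n; case: (odd _) => /=; lia.
Qed.

Definition interleave (p q : baire) : baire :=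
  fun i => if odd i then q i./2 else p i./2.

Lemma unpair_l_interleave p q : unpair_l (interleave p q) = p.
Proof. by apply/funext => i; rewrite /unpair_l/interleave mul2n odd_double doubleK. Qed.

Lemma unpair_r_interleave p q : unpair_r (interleave p q) = q.
Proof.
apply/funext => i; rewrite /unpair_r/interleave addn1 mul2n /= odd_double.
by rewrite uphalf_double.
Qed.

Definition interleaveE := (unpair_l_interleave, unpair_r_interleave).

Lemma comp_interleave (P Q : baire -> nat -> baire) f g :
  computable2 P -> computable2 Q -> computable f -> computable g ->
  computable (fun p x => interleave (P p (f p x)) (Q p (f p x)) (g p x)).
Proof.
move=> cP cQ cf cg.
have ch := comp_half cg; have co := comp_odd cg.
apply: (@comp_if (fun p x => odd (g p x)) (fun p x => Q p (f p x) (g p x)./2)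
  (fun p x => P p (f p x) (g p x)./2)) => //.
- exact: (@comp_app2 Q f (fun p x => (g p x)./2)).
- exact: (@comp_app2 P f (fun p x => (g p x)./2)).
Qed.

(** [relay] answers the oracle queries of [c] by the program for [P], with [x] as the parameter;
    this is how a type-2 program is applied to a computable family of names. *)
Lemma comp_subst c (P Q : baire -> nat -> baire) :
  (forall p x, type2_graph c (P p x) (Q p x)) -> computable2 P -> computable2 Q.
Proof.
move=> cQ [g gP].
pose g' := PComp g [:: PComp ppair [:: PProj 0; PProj 1]].
exists (PComp (relay g' c 1) [:: ppr1; ppr2]) => p z.
apply: runs2; [exact: runs_pr1| exact: runs_pr2|].
apply: (@runs_relay p (P p (pr1 z)) g' (pr1 z) c [:: pr2 z]); last exact: cQ.
move=> i; apply: runs1.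
  by apply: runs2; [exact: runs_proj| exact: runs_proj| exact: runs_pair].
by have := gP p (pairN (pr1 z) i); rewrite /= !prE.
Qed.

Lemma comp_computable (q : baire) : computable_baire q -> computable (fun=> q).
Proof.
move=> [c cq].
have c2 : computable2 (fun _ _ => q).
  by apply: (@comp_subst c (fun _ _ => no_oracle) (fun _ _ => q)) => //; exact: comp_const.
apply: comp_ext (@comp_app2 (fun _ _ => q) (fun=> id) (fun=> id) c2 comp_id comp_id).
by [].
Qed.

End Interleaving.

(** * Ideal balls *)

(** For each point, being covered by a set of index below [n] holds nearby for all large [n];
    near-covering compactness makes one bound [N] serve all of [K]. *)
Lemma compact_nat_cover (T : topologicalType) (K : set T) (A : set nat)
    (f : nat -> set T) :
  compact K -> (forall i, A i -> open (f i)) -> K `<=` \bigcup_(i in A) f i ->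
  exists w : seq nat, (forall i, i \in w -> A i) /\
    K `<=` \bigcup_(i in [set` w]) f i.
Proof.
move=> /compact_near_coveringP cK fo Kf.
have [x Kx|N _ NP] := cK nat \oo
    (fun n x => exists i, [/\ (i < n)%N, A i & f i x]) _.
  have [i Ai fix_] := Kf x Kx.
  exists (f i, [set n | (i < n)%N]) => /=; last by move=> [y n] [? ?]; exists i.
  by split; [exact: open_nbhs_nbhs (conj (fo i Ai) fix_)|exists i.+1].
exists [seq i <- iota 0 N | `[< A i >]]; split=> [i|x Kx].
  by rewrite mem_filter => /andP[/asboolP].
have [i [iN Ai fix_]] := NP N (leqnn N) x Kx.
exists i; last by [].
by rewrite /= mem_filter mem_iota iN !andbT; apply/asboolP.
Qed.

Lemma basisP (T : topologicalType) (B : set (set T)) (O : set T) (x : T) :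
  basis B -> open O -> O x -> exists V, [/\ B V, V x & V `<=` O].
Proof.
move=> [_ BP] oO Ox; have /BP[V [BV Vx] VO] : nbhs x O by exact: open_nbhs_nbhs.
by exists V.
Qed.

Section IdealBalls.
Local Open Scope ring_scope.
Context {R : realType} {T : metricType R} (nu : nat -> T).
Hypothesis hX : computable_metric_space nu.

Definition ideal_radius (n : nat) : R := ratr (nuQpos (pr2 n)).

Lemma nuQpos_gt0 r : 0 < nuQpos r.
Proof. by rewrite divr_gt0 ?ltr0n. Qed.

Lemma ideal_radius_gt0 n : 0 < ideal_radius n.
Proof. by rewrite ltr0q nuQpos_gt0. Qed.

Lemma alphaE n x : alpha nu n x = (mdist (nu (pr1 n)) x < ideal_radius n) :> Prop.
Proof. by rewrite /alpha ballEmdist. Qed.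

Lemma alpha_center n : alpha nu n (nu (pr1 n)).
Proof. by rewrite alphaE mdistxx ideal_radius_gt0. Qed.

Lemma open_ball (x : T) (e : R) : open (ball x e).
Proof.
rewrite openE ballEmdist => y /= xy; apply/nbhs_ballP.
exists (e - mdist x y); rewrite /= ?subr_gt0// => z; rewrite ballEmdist /= => yz.
by have := metric_triangle x y z; lra.
Qed.

Lemma open_alpha n : open (alpha nu n).
Proof. exact: open_ball. Qed.

Lemma open_bigcup_alpha (A : set nat) : open (\bigcup_(n in A) alpha nu n).
Proof. by apply: bigcup_open => n _; exact: open_alpha. Qed.

Lemma open_ideal_cover w : open (ideal_cover nu w).
Proof. exact: open_bigcup_alpha. Qed.

Lemma alpha_small (x : T) (e : R) : 0 < e ->
  exists n, alpha nu n x /\ ideal_radius n < e.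
Proof.
move=> e0; have [N Ne] : exists N : nat, N.+1%:R^-1 < e.
  by have [N _ /(_ N (leqnn N))] := near_infty_natSinv_lt (PosNum e0); exists N.
have N0 : (0 : R) < N.+1%:R^-1 by rewrite invr_gt0 ltr0n.
have [y [xy [k _ ky]]] : ball x (N.+1%:R^-1 : R) `&` range nu !=set0.
  by apply: hX.1; [exists x; exact: ballxx|exact: open_ball].
have rN : ideal_radius (pairN k (pairN 0 N)) = N.+1%:R^-1.
  by rewrite /ideal_radius /nuQpos !prE mul1r fmorphV rmorph_nat.
exists (pairN k (pairN 0 N)); rewrite alphaE rN prE ky; split=> //.
by move: xy; rewrite ballEmdist /= metric_sym.
Qed.

(** Holding for all sufficiently small ideal balls around [x]. Finitely many such requirements can
    be combined and then met by one ball. *)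
Definition fine_at (x : T) (P : nat -> Prop) : Prop :=
  exists2 e : R, 0 < e & forall n, alpha nu n x -> ideal_radius n < e -> P n.

Lemma fine_at_ex x P : fine_at x P -> exists n, alpha nu n x /\ P n.
Proof.
move=> [e /(alpha_small x)[n [nx ne]] eP].
by exists n; split=> //; exact: eP.
Qed.

Lemma fine_atI x P Q : fine_at x P -> fine_at x Q ->
  fine_at x (fun n => P n /\ Q n).
Proof.
move=> [e e0 eP] [f f0 fQ]; exists (Num.min e f); first by rewrite lt_min e0.
by move=> n nx; rewrite lt_min => /andP[? ?]; split; [exact: eP|exact: fQ].
Qed.

Lemma fine_atS x (P Q : nat -> Prop) :
  (forall n, P n -> Q n) -> fine_at x P -> fine_at x Q.
Proof. by move=> PQ [e e0 eP]; exists e => // n nx ne; exact/PQ/eP. Qed.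

Lemma fine_at_all x (P : nat -> nat -> Prop) N :
  (forall i, (i < N)%N -> fine_at x (P i)) ->
  fine_at x (fun n => forall i, (i < N)%N -> P i n).
Proof.
elim: N => [|N IHN] h; first by exists 1.
have {}IHN := IHN (fun i lt => h i (ltnW lt)).
apply: fine_atS (fine_atI IHN (h N (leqnn _))) => n [Pn PN] i.
by rewrite ltnS leq_eqVlt => /predU1P[->//|]; exact: Pn.
Qed.

(** The tripled ball leaves the room that later makes balls inside disjoint open sets formally
    disjoint. *)
Lemma fine_at_open x O : open O -> O x ->
  fine_at x (fun n => ball (nu (pr1 n)) (3 * ideal_radius n) `<=` O).
Proof.
rewrite openE => /[apply] /nbhs_ballP[e /= e0 eO].
(* A point of the tripled ball is within one plus three radii of [x]. *)
exists (e / 4) => [|n]; first by rewrite divr_gt0.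
rewrite alphaE => nx ne y; rewrite ballEmdist /= => ny; apply: eO.
rewrite ballEmdist /=; have := metric_triangle x (nu (pr1 n)) y.
by rewrite (metric_sym x (nu _)); lra.
Qed.

Lemma alpha_sub_ball3 n : alpha nu n `<=` ball (nu (pr1 n)) (3 * ideal_radius n).
Proof.
move=> y; rewrite alphaE ballEmdist /=; have := ideal_radius_gt0 n; lra.
Qed.

(** Formal inclusion: a strict inequality between computable reals, hence semidecidable, that
    implies inclusion of the balls. *)
Definition finc (m n : nat) : Prop :=
  mdist (nu (pr1 m)) (nu (pr1 n)) + ideal_radius m < ideal_radius n.

Lemma finc_sub m n : finc m n -> alpha nu m `<=` alpha nu n.
Proof.
rewrite /finc => mn x; rewrite !alphaE => mx.
have := metric_triangle (nu (pr1 n)) (nu (pr1 m)) x.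
by rewrite (metric_sym (nu (pr1 n)) (nu (pr1 m))); lra.
Qed.

Lemma fine_at_finc x n : alpha nu n x -> fine_at x (finc^~ n).
Proof.
(* Half of the slack, as the radius of [m] is spent twice: on the distance from its centre to [x]
   and on the ball itself. *)
rewrite alphaE => nx; exists ((ideal_radius n - mdist (nu (pr1 n)) x) / 2).
  by rewrite divr_gt0 // subr_gt0.
move=> m; rewrite alphaE /finc => mx.
have := metric_triangle (nu (pr1 m)) x (nu (pr1 n)).
by rewrite (metric_sym x (nu (pr1 n))); lra.
Qed.

Lemma formally_disjoint_alpha u v m n : formally_disjoint nu u v ->
  m \in u -> n \in v -> alpha nu m `&` alpha nu n = set0.
Proof.
move=> /allrelP uv mu nv; have := uv _ _ mu nv => mn.
rewrite -subset0 => x [] /=; rewrite !alphaE /ideal_radius => mx nx.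
have := metric_triangle (nu (pr1 m)) x (nu (pr1 n)).
by rewrite (metric_sym x (nu (pr1 n))); lra.
Qed.

Lemma diam_alpha A n (e : R) : A `<=` alpha nu n -> 2 * ideal_radius n < e ->
  (diam A < e%:E)%E.
Proof.
move=> An ne; have := ideal_radius_gt0 n => n0.
apply: (@le_lt_trans _ _ (2 * ideal_radius n)%:E); last by rewrite lte_fin.
apply: ge_ereal_sup => y [->|]; first by rewrite lee_fin; lra.
move=> [[a b] [/= /An + /An +] <-]; rewrite !alphaE lee_fin => na nb.
have := metric_triangle a (nu (pr1 n)) b.
by rewrite (metric_sym a (nu _)); lra.
Qed.

Lemma compact_ideal K (A : set nat) : compact K ->
  K `<=` \bigcup_(n in A) alpha nu n ->
  exists w, (forall n, n \in w -> A n) /\ K `<=` ideal_cover nu w.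
Proof. by move=> cK; apply: compact_nat_cover => // n _; exact: open_alpha. Qed.

Lemma bigcup_alphaT : \bigcup_n alpha nu n = setT.
Proof.
rewrite -subTset => x _; have [n [nx _]] := alpha_small x ltr01.
by exists n.
Qed.

(** Clears denominators and moves the subtracted term across, so that the comparison of rationals is
    decided by arithmetic on natural numbers. *)
Lemma nuQ_lt_nat (a k m n : nat) :
  (nuQ a + (2 ^+ k)^-1 + nuQpos m < nuQpos n) =
  ((pr1 (pr1 a) * 2 ^ k + (pr2 a).+1) * (pr2 m).+1 * (pr2 n).+1
     + (pr1 m).+1 * (pr2 a).+1 * 2 ^ k * (pr2 n).+1
   < ((pr1 n).+1 * (pr2 a).+1 + pr2 (pr1 a) * (pr2 n).+1) * 2 ^ k * (pr2 m).+1)%N.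
Proof.
rewrite -(ltr_nat rat) !(natrD, natrM, natrX) /nuQ /nuQpos.
move: (pr1 (pr1 a))%:R (pr2 (pr1 a))%:R (pr1 m).+1%:R (pr1 n).+1%:R => A B M N.
have : 0 < 2 ^+ k :> rat by rewrite exprn_gt0.
have : 0 < (pr2 n).+1%:R :> rat by rewrite ltr0n.
have : 0 < (pr2 m).+1%:R :> rat by rewrite ltr0n.
have : 0 < (pr2 a).+1%:R :> rat by rewrite ltr0n.
move: (pr2 a).+1%:R (pr2 m).+1%:R (pr2 n).+1%:R (2 ^+ k) => c m' n' P c0 m0 n0 P0.
have X0 : 0 < c * m' * n' * P by rewrite !mulr_gt0.
rewrite -(ltr_pM2r X0) -subr_gt0 -[RHS]subr_gt0; congr (_ < _); field.
by rewrite !gt_eqF.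
Qed.

Lemma finc_approx (f : baire) :
  (forall i j k, `|mdist (nu i) (nu j) - ratr (nuQ (f (pairN i (pairN j k))))|
     <= (2 ^+ k)^-1) ->
  forall m n, finc m n <->
    exists k, nuQ (f (pairN (pr1 m) (pairN (pr1 n) k))) + (2 ^+ k)^-1 +
      nuQpos (pr2 m) < nuQpos (pr2 n).
Proof.
move=> fP m n; rewrite /finc /ideal_radius; split=> [mn|[k]]; last first.
  have := fP (pr1 m) (pr1 n) k; rewrite ler_norml => /andP[_ fk].
  rewrite -(ltr_rat R) !rmorphD /= fmorphV rmorphXn /= rmorph_nat => ?; lra.
(* The slack in the inequality. The error [2 ^- k] enters twice, once in the approximation and once
   as the added margin, so it has to be below [e / 2]. *)
set e := ratr (nuQpos (pr2 n)) - ratr (nuQpos (pr2 m)) - mdist (nu (pr1 m)) (nu (pr1 n)).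
have e0 : 0 < e / 2 by rewrite divr_gt0// /e; lra.
have [k _ /(_ k (leqnn k)) /= ke] := near_infty_natSinv_lt (PosNum e0).
have k2 : ((2 : R) ^+ k)^-1 < e / 2.
  apply: le_lt_trans ke; rewrite lef_pV2 ?posrE ?exprn_gt0 ?ltr0n//.
  by rewrite -natrX ler_nat ltn_expl.
exists k; have := fP (pr1 m) (pr1 n) k; rewrite ler_norml => /andP[fk _].
rewrite -(ltr_rat R) !rmorphD /= fmorphV rmorphXn /= rmorph_nat.
by move: k2; rewrite /e; lra.
Qed.

Lemma sig1_finc : sig2 (fun _ => finc).
Proof.
have [f [/comp_computable cf fP]] := hX.2.
pose S (p : baire) m n k :=
  let a := f (pairN (pr1 m) (pairN (pr1 n) k)) in
  ((pr1 (pr1 a) * 2 ^ k + (pr2 a).+1) * (pr2 (pr2 m)).+1 * (pr2 (pr2 n)).+1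
     + (pr1 (pr2 m)).+1 * (pr2 a).+1 * 2 ^ k * (pr2 (pr2 n)).+1
   < ((pr1 (pr2 n)).+1 * (pr2 a).+1 + pr2 (pr1 a) * (pr2 (pr2 n)).+1)
      * 2 ^ k * (pr2 (pr2 m)).+1)%N.
have cS : sig2 (fun p m n => exists k, S p m n k).
  by rewrite /S /=; effective.
apply: sig1_ext cS => p z; rewrite (finc_approx fP).
by split=> -[k kS]; exists k; move: kS; rewrite nuQ_lt_nat.
Qed.

End IdealBalls.

(** * Families of open and compact sets with computable names *)

Section Families.
Context {R : realType} {T : metricType R} (nu : nat -> T).
Hypothesis hX : computable_metric_space nu.
Implicit Types (V W K : baire -> nat -> set T) (Q : baire -> nat -> baire).

(** One semidecidable relation lists the balls of all members, uniformly in the oracle [p] and the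
    index [x]. *)
Definition sig_open W : Prop :=
  exists2 A : baire -> nat -> nat -> Prop, sig2 A &
    forall p x, W p x = \bigcup_(n in A p x) alpha nu n.

Definition sig_cover W : Prop :=
  sig2 (fun p x v => W p x `<=` ideal_cover nu (word v)).

(** Position [pairN n k] of the name lists the ball [n] when [k] witnesses it, and otherwise carries
    0, which adds nothing. *)
Lemma sig_open_name W : sig_open W ->
  exists2 Q, computable2 Q & forall p x, delta_Sigma nu (Q p x) (W p x).
Proof.
move=> [A [G cG AG] WA].
have AP p x n : A p x n <-> exists k, G p (pairN x n) k by rewrite -AG !prE.
exists (fun p x i => if G p (pairN x (pr1 i)) (pr2 i) then (pr1 i).+1 else 0).
  apply: (@comp_if (fun p z => G p (pairN (pr1 z) (pr1 (pr2 z))) (pr2 (pr2 z)))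
    (fun p z => (pr1 (pr2 z)).+1) (fun _ _ => 0)); effective.
move=> p x; rewrite /delta_Sigma WA; apply/seteqP; split=> y [n /=].
  move=> /AP[k Gk] ny; exists (pairN n k) => /=; rewrite !prE Gk//.
by case: ifP => // Gk _ ny; exists (pr1 n) => //; apply/AP; exists (pr2 n).
Qed.

Lemma name_sig_open W Q : computable2 Q ->
  (forall p x, delta_Sigma nu (Q p x) (W p x)) -> sig_open W.
Proof.
move=> cQ QW; exists (fun p x n => exists i, Q p x i = n.+1); first by effective.
move=> p x; rewrite (QW p x); apply/seteqP; split=> y [i /=].
  by move=> Qi iy; exists (Q p x i).-1 => //; exists i; rewrite prednK.
by move=> [j Qj] iy; exists j; rewrite /= Qj.
Qed.

(** A cover name has no blank entry, so positions without a witness repeat one covering word [h p x]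
    found by effective choice. *)
Lemma sig_cover_name W : (forall p x, compact (W p x)) -> sig_cover W ->
  exists2 Q, computable2 Q & forall p x, delta_cover nu (Q p x) (W p x).
Proof.
move=> cW sW; have [|h ch hP] :=
    @sig1_choice (fun p x v => W p x `<=` ideal_cover nu (word v)) sW.
  move=> p x.
  have [|w [_ Ww]] := @compact_ideal _ _ nu _ setT (cW p x).
    by rewrite (bigcup_alphaT hX).
  by exists (wcode w); rewrite /wcode CodeSeq.codeK.
have [G cG sG] := sW.
have GP p x v : W p x `<=` ideal_cover nu (word v) <-> exists k, G p (pairN x v) k.
  by rewrite -sG !prE.
exists (fun p x i => if G p (pairN x (pr1 i)) (pr2 i) then pr1 i else h p x).
  apply: (@comp_if (fun p z => G p (pairN (pr1 z) (pr1 (pr2 z))) (pr2 (pr2 z)))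
    (fun p z => pr1 (pr2 z)) (fun p z => h p (pr1 z))); effective.
move=> p x; split=> //; apply/seteqP; split=> v /=.
  move=> [i _ <-]; exists (word (if G p (pairN x (pr1 i)) (pr2 i) then pr1 i else h p x)).
    by case: ifP => // Gk; apply/GP; exists (pr2 i).
  exact: CodeSeq.decodeK.
move=> [w Ww <-]; have /GP[k Gk] : W p x `<=` ideal_cover nu (word (wcode w)).
  by rewrite /wcode CodeSeq.codeK.
by exists (pairN (wcode w) k) => //; rewrite !prE Gk.
Qed.

Lemma delta_coverP q C v : delta_cover nu q C ->
  C `<=` ideal_cover nu (word v) <-> exists i, q i = v.
Proof.
move=> [_ qC]; split=> [Cv|[i qi]].
  have [i _ qi] : range q v.
    by rewrite qC; exists (word v) => //; exact: CodeSeq.decodeK.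
  by exists i.
have [w Cw <-] : [set wcode w | w in [set w | C `<=` ideal_cover nu w]] v.
  by rewrite -qC; exists i.
by rewrite /wcode CodeSeq.codeK.
Qed.

Lemma name_sig_cover W Q : computable2 Q ->
  (forall p x, delta_cover nu (Q p x) (W p x)) -> sig_cover W.
Proof.
move=> cQ QW; have s : sig2 (fun p x v => exists i, Q p x i = v) by effective.
by apply: sig1_ext s => p z; rewrite (delta_coverP _ (QW _ _)).
Qed.

Lemma sig_open_app W f : sig_open W -> computable f -> sig_open (fun p x => W p (f p x)).
Proof.
move=> [A sA WA] cf; exists (fun p x n => A p (f p x) n) => //.
by effective.
Qed.

Lemma sig_cover_app W f : sig_cover W -> computable f ->
  sig_cover (fun p x => W p (f p x)).
Proof.
move=> sW cf; rewrite /sig_cover.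
apply: (@sig1_app2 (fun p x v => W p x `<=` ideal_cover nu (word v))
  (fun p z => f p (pr1 z)) (fun p z => pr2 z)) => //; by effective.
Qed.

Lemma sig_open_bigcup (S : baire -> nat -> nat -> Prop)
    (W : baire -> nat -> nat -> set T) :
  sig2 S -> sig_open (fun p z => W p (pr1 z) (pr2 z)) ->
  sig_open (fun p x => \bigcup_(i in S p x) W p x i).
Proof.
move=> sS [A sA WA].
exists (fun p x n => exists i, S p x i /\ A p (pairN x i) n); first by effective.
move=> p x; apply/seteqP; split=> y.
  move=> [i Si]; have := WA p (pairN x i); rewrite !prE => -> [n An ny].
  by exists n => //; exists i.
move=> [n [i [Si An]] ny]; exists i => //.
by have := WA p (pairN x i); rewrite !prE => ->; exists n.
Qed.

Lemma sig_openU V W : sig_open V -> sig_open W ->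
  sig_open (fun p x => V p x `|` W p x).
Proof.
move=> [A sA VA] [B sB WB].
exists (fun p x n => A p x n \/ B p x n); first by effective.
by move=> p x; rewrite VA WB bigcup_setU.
Qed.

(** Lists the balls formally included in a ball of [V] and in a ball of each [W i]. These finitely
    many requirements hold for all fine enough balls around a point of the intersection. *)
Lemma sig_open_bigcap V (W : baire -> nat -> nat -> set T) f :
  sig_open V -> sig_open (fun p z => W p (pr1 z) (pr2 z)) -> computable f ->
  sig_open (fun p x => V p x `&` \bigcap_(i in [set i | i < f p x]) W p x i).
Proof.
move=> [A sA VA] [B sB WB] cf; have sF := sig1_finc hX.
exists (fun p x n => (exists m, A p x m /\ finc nu n m) /\
    forall i, i < f p x -> exists m, B p (pairN x i) m /\ finc nu n m).
  by effective.
have WE p x i : W p x i = \bigcup_(n in B p (pairN x i)) alpha nu n.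
  by rewrite -WB !prE.
move=> p x; rewrite VA; apply/seteqP; split=> y.
  move=> [[m Am my] yW].
  have fA : fine_at nu y (fun n => exists m, A p x m /\ finc nu n m).
    by apply: fine_atS (fine_at_finc my) => n nm; exists m.
  have fB i : i < f p x ->
      fine_at nu y (fun n => exists m, B p (pairN x i) m /\ finc nu n m).
    move=> /yW; rewrite WE => -[l Bl ly].
    by apply: fine_atS (fine_at_finc ly) => n nm; exists l.
  have [n [ny nP]] := fine_at_ex hX (fine_atI fA (fine_at_all fB)).
  by exists n.
move=> [n [[m [Am nm]] nW] ny]; split; first by exists m => //; exact: finc_sub nm _ ny.
move=> i /nW[l [Bl nl]]; rewrite WE; exists l => //; exact: finc_sub nl _ ny.
Qed.

(** A word covers [W p x] iff some word covering [K p x] consists of its balls and of balls listed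
    in the complement of [W p x]; compactness of [K p x] supplies the finite word. *)
Lemma sig_cover_sub K W : (forall p x, compact (K p x)) -> sig_cover K ->
  sig_open (fun p x => ~` W p x) -> (forall p x, W p x `<=` K p x) ->
  sig_cover W.
Proof.
move=> cK sK [A sA WA] WK.
have s : sig2 (fun p x v => exists u, K p x `<=` ideal_cover nu (word u) /\
    forall a, a \in word u -> a \in word v \/ A p x a).
  have sK' : sig2 (fun p x u => K p x `<=` ideal_cover nu (word u)) := sK.
  apply: (@sig1_ex (fun p z u => K p (pr1 z) `<=` ideal_cover nu (word u) /\
    forall a, a \in word u -> a \in word (pr2 z) \/ A p (pr1 z) a)).
  apply: sig1_and; last by effective.
  apply: (@sig1_app2 (fun p x u => K p x `<=` ideal_cover nu (word u))
    (fun p z => pr1 (pr1 z)) (fun p z => pr2 z)) => //; by effective.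
apply: sig1_ext s => p z; set x := pr1 z; set v := pr2 z.
split=> [[u [Ku uv]] y Wy|Wv].
  have [a /= /uv[av|Aa] ay] := Ku _ (WK _ _ _ Wy); first by exists a.
  by have : (~` W p x) y by rewrite WA; exists a.
have [|w [wP Kw]] := @compact_ideal _ _ nu _
    [set a | a \in word v \/ A p x a] (cK p x).
  move=> y Ky; have [/Wv[a av ay]|] := pselect (W p x y); first by exists a => //; left.
  by rewrite -[~ _]/((~` W p x) y) WA => -[a Aa ay]; exists a => //; right.
by exists (wcode w); rewrite /wcode CodeSeq.codeK; split.
Qed.

Lemma comp2_interleave P Q : computable2 P -> computable2 Q ->
  computable2 (fun p x => interleave (P p x) (Q p x)).
Proof.
by move=> cP cQ; apply: (@comp_interleave P Q (fun _ z => pr1 z) (fun _ z => pr2 z)) => //;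
  effective.
Qed.

Lemma computable_fun_nat_name Y (dY : rep Y) (b : nat -> Y) :
  computable_fun rep_nat dY b ->
  exists2 q : nat -> baire, computable2 (fun _ => q) & forall x, dY (q x) (b x).
Proof.
move=> [c cP].
(* The constant sequence [x] serves as a name of the number [x]. *)
have /choice[q qP] x : exists q, type2_graph c (fun=> x) q /\ dY q (b x).
  by have [q [cq [y [qy <-]]]] := cP (fun=> x) x erefl I; exists q.
exists q => [|x]; last by have [] := qP x.
apply: (@comp_subst c (fun _ x _ => x) (fun _ => q)); last by effective.
by move=> _ x; have [] := qP x.
Qed.

Lemma name_computable_fun_nat Y (dY : rep Y) (b : nat -> Y) Q :
  computable2 Q -> (forall p x, dY (Q p x) (b x)) -> computable_fun rep_nat dY b.
Proof.
move=> cQ QP.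
have [c cP] : computable (fun p n => Q p (p 0) n) by effective.
exists c => p x <- _; exists (Q p (p 0)); split; first exact: cP.
by exists (b (p 0)).
Qed.

Lemma delta_Delta_interleave q1 q2 (A : set T) : delta_Sigma nu q1 A ->
  delta_Sigma nu q2 (~` A) -> delta_Delta nu (interleave q1 q2) A.
Proof.
move=> q1A q2A; rewrite /delta_Delta !interleaveE; split=> //.
by exists (~` A); rewrite setCK.
Qed.

Lemma delta_Delta_open q (A : set T) : delta_Delta nu q A -> open A.
Proof.
by move=> [-> _]; apply: bigcup_open => i _; exact: open_alpha.
Qed.

Lemma delta_Delta_closed q (A : set T) : delta_Delta nu q A -> closed A.
Proof.
move=> [_ [U [-> ->]]]; apply/open_closedC/bigcup_open => i _.
exact: open_alpha.
Qed.

Lemma sig_open_clopen_name W : sig_open W -> sig_open (fun p x => ~` W p x) ->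
  exists2 Q, computable2 Q & forall p x, delta_Delta nu (Q p x) (W p x).
Proof.
move=> /sig_open_name[Q1 c1 Q1W] /sig_open_name[Q2 c2 Q2W].
exists (fun p x => interleave (Q1 p x) (Q2 p x)); first exact: comp2_interleave.
by move=> p x; exact: delta_Delta_interleave.
Qed.

Lemma name_sig_open_clopen W Q : computable2 Q ->
  (forall p x, delta_Delta nu (Q p x) (W p x)) ->
  sig_open W /\ sig_open (fun p x => ~` W p x).
Proof.
move=> cQ QW; split.
  apply: (@name_sig_open _ (fun p x => unpair_l (Q p x))).
    by rewrite /unpair_l; effective.
  by move=> p x; have [] := QW p x.
apply: (@name_sig_open _ (fun p x => unpair_r (Q p x))).
  by rewrite /unpair_r; effective.
by move=> p x; have [_ [U [UQ ->]]] := QW p x; rewrite setCK.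
Qed.

Definition sig_KO W : Prop :=
  [/\ forall p x, compact (W p x), sig_open W,
      sig_open (fun p x => ~` W p x) & sig_cover W].

Lemma sig_KO_KO W p x : sig_KO W -> KO (W p x).
Proof.
by move=> [cW [A _ WA] _ _]; split=> //; rewrite WA; exact: open_bigcup_alpha.
Qed.

Lemma computable_KO (b : nat -> set T) :
  computable_fun rep_nat (delta_KO nu) b <-> sig_KO (fun _ => b).
Proof.
split=> [/computable_fun_nat_name[q cq qP]|bKO].
  have [bO bC] : sig_open (fun _ => b) /\ sig_open (fun _ x => ~` b x).
    apply: (@name_sig_open_clopen (fun _ => b) (fun _ x => unpair_l (q x))).
      by rewrite /unpair_l; effective.
    by move=> _ x; have [_ []] := qP x.
  split=> //; first by move=> _ x; have [[]] := qP x.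
  apply: (@name_sig_cover _ (fun _ x => unpair_r (q x))).
    by rewrite /unpair_r; effective.
  by move=> _ x; have [_ []] := qP x.
have [bc bO bC bK] := bKO.
have [Q1 c1 Q1P] := sig_open_clopen_name bO bC.
have [Q2 c2 Q2P] := sig_cover_name bc bK.
apply: (@name_computable_fun_nat _ _ _ (fun p x => interleave (Q1 p x) (Q2 p x))).
  exact: comp2_interleave.
by move=> p x; split; [exact: (sig_KO_KO p x bKO)|rewrite !interleaveE].
Qed.

End Families.

(** * The implications *)

(** Lets information be read off a halting run: the zero found by [PMu] must be the value that the
    program is known to compute. *)
Lemma runs_det p c v r r' : runs p c v r -> runs p c v r' -> r = r'.
Proof.
move=> h; move: c v r h r'.
apply: (@runs_mind p (fun c v r => forall r', runs p c v r' -> r = r')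
  (fun gs v ws => forall ws', runs_seq p gs v ws' -> ws = ws')).
- by move=> v r'; inversion 1.
- by move=> v r'; inversion 1.
- by move=> i v r'; inversion 1.
- by move=> v r'; inversion 1.
- move=> f gs v ws r _ IHgs _ IHf r'; inversion 1; subst; apply: IHf.
  by match goal with hs : runs_seq p gs v _ |- _ => rewrite (IHgs _ hs) end.
- by move=> f g v r _ IHf r'; inversion 1; subst; exact: IHf.
- move=> f g n v s r _ IHf _ IHg r'; inversion 1; subst; apply: IHg.
  by match goal with hs : runs p (PRec f g) _ _ |- _ => rewrite (IHf _ hs) end.
- move=> f v n h _ IHf _ IHf0 n'; inversion 1; subst.
  (* If the two search results differed, the test at the smaller one would be both zero and
     positive. *)
  case: (ltngtP n n') => // lt.
    match goal with hs : forall m, is_true (m < n') -> _ |- _ =>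
      by have := IHf0 _ (hs _ lt) end.
  by match goal with hs : runs p f (n' :: v) 0 |- _ =>
    have := IHf _ lt _ hs end.
- by move=> v ws'; inversion 1.
- move=> g gs v w ws _ IHg _ IHgs ws'; inversion 1; subst.
  by congr (_ :: _); [exact: IHg|exact: IHgs].
Qed.

(** The unbounded search for a witness halts exactly on the related pairs. *)
Lemma sig2_ce (S : nat -> nat -> Prop) : sig2 (fun _ => S) -> ce_rel S.
Proof.
move=> [G cG SG]; have [c cP] := comp_neg cG.
pose f := PComp c [:: PComp ppair [:: PComp ppair [:: PProj 1; PProj 2]; PProj 0]].
have fP m n k : runs no_oracle f [:: k; m; n] (~~ G no_oracle (pairN m n) k).
  apply: runs1.
    apply: runs2; [|exact: runs_proj|exact: runs_pair].
    by apply: runs2; [exact: runs_proj|exact: runs_proj|exact: runs_pair].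
  by have := cP no_oracle (pairN (pairN m n) k); rewrite !prE.
exists (PMu f) => m n; have := SG no_oracle (pairN m n); rewrite !prE => ->.
split=> [Gex|[r]].
  exists (ex_minn Gex); case: ex_minnP => k Gk kmin.
  apply: (@EvMu _ _ _ _ (fun=> 0)) => [i ik|]; last by have := fP m n k; rewrite Gk.
  have := fP m n i; case: (boolP (G _ _ i)) => // /kmin; by rewrite leqNgt ik.
inversion 1; subst; exists r.
match goal with hs : runs _ f _ 0 |- _ => have := runs_det (fP m n r) hs end.
by case: (G _ _ r).
Qed.

Section Implications.
Context {R : realType} {T : metricType R} (nu : nat -> T).
Hypothesis hX : computable_metric_space nu.

(** Condition (2) with names replaced by semidecidable data; every implication passes through it. *)
Definition KO_basis (b : nat -> set T) : Prop :=
  basis (range b) /\ sig_KO nu (fun _ => b).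

Lemma basis_intro (S : topologicalType) (B : set (set S)) :
  B `<=` open ->
  (forall x O, open O -> O x -> exists V, [/\ B V, V x & V `<=` O]) -> basis B.
Proof.
move=> Bo BP; split=> // x N; rewrite nbhsE => -[] O [Oo Ox] ON.
by have [V [BV Vx VO]] := BP x O Oo Ox; exists V => //; exact: subset_trans ON.
Qed.

Lemma KO_basis_cond4 b : KO_basis b ->
  exists S, [/\ computable_fun rep_nat (delta_Delta nu) b, ce_rel S,
    refined_inclusion nu b S & basis (range b)].
Proof.
move=> [bB [bc bO bC bK]]; exists (fun m n => b m `<=` alpha nu n); split=> //.
- have [Q cQ QP] := sig_open_clopen_name bO bC.
  exact: name_computable_fun_nat cQ QP.
- apply: sig2_ce.
  (* [2 ^ n] is the code of the one-letter word [n], so being covered by that word is inclusion in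
     the ball [n]. *)
  have s : sig2 (fun p m n => b m `<=` ideal_cover nu (word (2 ^ n))).
    apply: (@sig1_app2 (fun p m v => b m `<=` ideal_cover nu (word v))
      (fun p z => pr1 z) (fun p z => 2 ^ pr2 z)) => //; by effective.
  apply: sig1_ext s => p z; rewrite -[2 ^ _]muln1.
  rewrite -(wcode_cons _ [::]) /wcode CodeSeq.codeK /ideal_cover.
  by rewrite set_cons1 bigcup_set1.
- split=> // n x nx.
  have [V [[m _ <-] mx mn]] := basisP bB (open_alpha nu n) nx.
  by exists m.
Qed.

(** Index [pairN a i] denotes the i-th set returned for [gamma a]. Such a set is clopen by its name
    and compact as a closed subset of the second component; those through a point of a basic set
    stay inside it. *)
Lemma cond3_KO_basis (gamma : nat -> set T * set T) :
  Dhat_computable nu ->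
  computable_fun rep_nat (rep_prod (delta_Sigma nu) (delta_cover nu)) gamma ->
  basis (range (fun a => (gamma a).1)) ->
  (forall a, (gamma a).1 `<=` (gamma a).2) ->
  exists b, KO_basis b.
Proof.
move=> [c cP] /computable_fun_nat_name[P computableP PP] gB gsub.
(* Fixes the output of the program on each name [P x] together with the sets that this output
   names. *)
have /choice[Ny NyP] x : exists qy : baire * ((nat -> set T) * baire * baire),
    [/\ type2_graph c (P x) qy.1,
        forall i, delta_Delta nu
          (untuple (unpair_l (unpair_l qy.1)) i) (qy.2.1.1 i) &
        \bigcup_i (qy.2.1.1 i) = (gamma x).1].
  have [q [cq [[[W r] s] [[[/= WP _] _] [_ WU _ _ _]]]]] := cP _ _ (PP x) (gsub x).
  by exists (q, (W, r, s)).
pose N x := (Ny x).1.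
have cN : computable2 (fun _ => N).
  apply: (@comp_subst c (fun _ => P) (fun _ => N)) => // _ x.
  by have [] := NyP x.
pose b z := (Ny (pr1 z)).2.1.1 (pr2 z).
have bU z : b z `<=` (gamma (pr1 z)).1.
  by have [_ _ <-] := NyP (pr1 z) => y bzy; exists (pr2 z).
pose q z := untuple (unpair_l (unpair_l (N (pr1 z)))) (pr2 z).
have qb z : delta_Delta nu (q z) (b z) by have [_ + _] := NyP (pr1 z); exact.
have [bO bC] : sig_open nu (fun _ => b) /\ sig_open nu (fun _ x => ~` b x).
  apply: (@name_sig_open_clopen _ _ nu (fun _ => b) (fun _ => q)) => //.
  by rewrite /q /untuple /unpair_l; effective.
have gK x : compact (gamma x).2 by have [_ []] := PP x.
have bK z : b z `<=` (gamma (pr1 z)).2 by apply: subset_trans (bU z) _.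
have sK : sig_cover nu (fun _ z => (gamma (pr1 z)).2).
  apply: (@sig_cover_app _ _ nu (fun _ x => (gamma x).2) (fun _ z => pr1 z));
    last by effective.
  apply: (@name_sig_cover _ _ nu _ (fun _ x => unpair_r (P x))).
    by rewrite /unpair_r; effective.
  by move=> _ x; have [] := PP x.
exists b; split; last first.
  split=> //; last exact: (@sig_cover_sub _ _ nu (fun _ z => (gamma (pr1 z)).2)).
  move=> _ z; apply: subclosed_compact (gK (pr1 z)) _ => //.
  exact: delta_Delta_closed (qb z).
apply: basis_intro => [_ [z _ <-]|x O Oo Ox].
  exact: delta_Delta_open (qb z).
have [V [[a _ <-] ax aO]] := basisP gB Oo Ox.
have [_ _ aU] := NyP a; move: (ax); rewrite -aU => -[i _ ix].
exists (b (pairN a i)); split; first by exists (pairN a i).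
  by rewrite /b !prE.
by apply: subset_trans aO => y; move/bU; rewrite prE.
Qed.

End Implications.

(** * Formally disjoint covers in dimension zero *)

Section Disjoint.
Context {R : realType} {T : metricType R} (nu : nat -> T).
Hypothesis hX : computable_metric_space nu.

(** Covering dimension 0 refines [O] by disjoint open sets [V j]. Compactness selects finitely many
    ideal balls satisfying [P] whose tripled balls each lie in some [V j], and grouping them by [j]
    gives the words. *)
Lemma disjoint_refinement (k : nat) (O : 'I_k -> set T) (P : nat -> Prop) :
  compact [set: T] -> covdim_le [set: T] 0 ->
  (forall i, open (O i)) -> [set: T] `<=` \bigcup_i O i ->
  (forall x, fine_at nu x P) ->
  exists ws, [/\ pairwise (formally_disjoint nu) ws,
    [set: T] `<=` \bigcup_(w in [set` ws]) ideal_cover nu w,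
    forall w, w \in ws -> exists i, ideal_cover nu w `<=` O i &
    forall w n, w \in ws -> n \in w -> P n].
Proof.
move=> cT dimT Oo OT PT.
have [l [V [Vo VT VO Vdisj]]] := dimT k O Oo OT.
have {}Vo j : open (V j) by have [G Go ->] := Vo j; rewrite setTI.
(* In dimension 0 an intersection over two distinct indices is already empty. *)
have Vdisj2 i j x : i != j -> V i x -> V j x -> False.
  move=> ij ix jx; suff : set0 x by [].
  rewrite -(Vdisj [set i; j]%SET); last by rewrite cards2 ij.
  by move=> h /=; rewrite in_set2 => /orP[]/eqP->.
pose inV j n := ball (nu (pr1 n)) (3 * ideal_radius n)%R `<=` V j.
have inVV j n : inV j n -> alpha nu n `<=` V j.
  by move=> h; apply: subset_trans h; exact: alpha_sub_ball3.
have [|w [wA Tw]] := @compact_ideal _ _ nu _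
    [set n | P n /\ exists j, inV j n] cT.
  move=> x _; have [j _ Vjx] := VT x I.
  have [n [nx [nP nV]]] := fine_at_ex hX (fine_atI (PT x) (fine_at_open nu (Vo j) Vjx)).
  by exists n => //; split=> //; exists j.
pose ws := [seq [seq n <- w | `[< inV j n >]] | j <- enum 'I_l].
exists ws; split.
- rewrite pairwise_map; have := enum_uniq 'I_l; rewrite uniq_pairwise.
  apply: sub_pairwise => i j /= ij; apply/allrelP => m n.
  rewrite !mem_filter => /andP[/asboolP mi _] /andP[/asboolP nj _].
  (* The centre of [d] lies in [V b], hence outside the tripled ball of [c]. The distance of the
     centres is thus at least three times either radius, and exceeds their sum. *)
  have far a b c d : a != b -> inV a c -> inV b d ->
      (3 * ideal_radius c <= mdist (nu (pr1 c)) (nu (pr1 d)) :> R)%R.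
    move=> ab ca db; rewrite leNgt; apply/negP => lt.
    apply: (Vdisj2 a b (nu (pr1 d)) ab); first by apply: ca; rewrite ballEmdist.
    exact: inVV db _ (alpha_center nu d).
  have := far i j m n ij mi nj.
  have := far j i n m; rewrite eq_sym => /(_ ij nj mi); rewrite metric_sym.
  have := ideal_radius_gt0 (R := R) m; have := ideal_radius_gt0 (R := R) n.
  by rewrite /ideal_radius; lra.
- move=> x _; have [n /= nw nx] := Tw x I; have [_ [j jn]] := wA n nw.
  exists [seq n <- w | `[< inV j n >]].
    by apply/mapP; exists j => //; rewrite mem_enum.
  by exists n => //=; rewrite mem_filter nw andbT; apply/asboolP.
- move=> _ /mapP[j _ ->]; have [i ji] := VO j; exists i => x [n /=].
  by rewrite mem_filter => /andP[/asboolP nj _] nx; exact/ji/(inVV _ _ nj).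
- move=> _ n /mapP[j _ ->]; rewrite mem_filter => /andP[_ nw].
  by have [] := wA n nw.
Qed.

(** Index [pairN t j] denotes the j-th piece of the t-th enumerated tuple, and the empty set when
    [j] is beyond the tuple. *)
Lemma cond1_KO_basis :
  computable_point (delta_disj_cover' nu) [set: T] -> exists b, KO_basis nu b.
Proof.
move=> [p [/comp_computable cp [[cT dimT] pE]]].
(* A blank entry has predecessor 0 and reads as the empty tuple, all of whose pieces are empty. *)
pose tup t := word (p t).-1.
pose piece t j := word (nth 0 (tup t) j).
pose b z := ideal_cover nu (piece (pr1 z) (pr2 z)).
have piece_default t j : size (tup t) <= j -> piece t j = [::].
  by move=> le; rewrite /piece nth_default.
have tupP t : 0 < size (tup t) \/ 0 < p t -> exists ws,
    [/\ tup t = map wcode ws, pairwise (formally_disjoint nu) ws &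
      [set: T] `<=` \bigcup_(w in [set` ws]) ideal_cover nu w].
  move=> pt0; have pt : 0 < p t by case: pt0; rewrite // /tup; case: (p t).
  have [ws [fd cov] wsE] : [set wcode (map wcode ws) | ws in
     [set ws | pairwise (formally_disjoint nu) ws /\
       [set: T] `<=` \bigcup_(w in [set` ws]) ideal_cover nu w]] (p t).-1.
    by rewrite -pE; exists t; rewrite prednK.
  by exists ws; rewrite /tup -wsE /wcode CodeSeq.codeK.
have piece_nth t ws j : tup t = map wcode ws -> piece t j = nth [::] ws j.
  move=> tE; rewrite /piece tE; have [lt|ge] := ltnP j (size ws).
    by rewrite (nth_map [::])// /wcode CodeSeq.codeK.
  by rewrite !nth_default// size_map.
have tup_ex ws : pairwise (formally_disjoint nu) ws ->
    [set: T] `<=` \bigcup_(w in [set` ws]) ideal_cover nu w ->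
    exists t, 0 < p t /\ tup t = map wcode ws.
  move=> fd cov; have [t pt] : [set a | exists i, p i = a.+1] (wcode (map wcode ws)).
    by rewrite pE; exists ws.
  by exists t; rewrite /tup pt /wcode CodeSeq.codeK.
have bO : sig_open nu (fun _ => b).
  exists (fun _ z n => n \in piece (pr1 z) (pr2 z)) => //.
  by rewrite /piece /tup; effective.
have bC : sig_open nu (fun _ z => ~` b z).
  (* Beyond the tuple the piece is empty and every ball is listed; otherwise the balls of the other
     pieces are. *)
  exists (fun _ z n => size (tup (pr1 z)) <= pr2 z \/
    exists j, j < size (tup (pr1 z)) /\ ~~ (j == pr2 z) /\ n \in piece (pr1 z) j).
    by rewrite /piece /tup; effective.
  move=> _ z; set t := pr1 z; set j := pr2 z; apply/seteqP; split=> y.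
    move=> nby; have [lt|ge] := ltnP j (size (tup t)); last first.
      have [n [ny _]] := alpha_small hX y ltr01.
      by exists n => //; left.
    have [ws [tE fd cov]] : exists ws, [/\ tup t = map wcode ws,
        pairwise (formally_disjoint nu) ws &
        [set: T] `<=` \bigcup_(w in [set` ws]) ideal_cover nu w].
      by apply: tupP; left; exact: leq_trans lt.
    have [w /= /(nthP [::])[i ilt <-] [n nw ny]] := cov y I.
    exists n => //; right; exists i; rewrite tE size_map ilt.
    rewrite (piece_nth _ ws)//; split=> //; split=> //.
    apply/eqP => ij; apply: nby; exists n => //.
    by rewrite /= (piece_nth _ ws)// -/j -ij.
  move=> [n /= nP ny] [m /= mw my].
  case: nP => [le|[i [ilt [ij ni]]]]; first by move: mw; rewrite piece_default.
  have jlt : j < size (tup t).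
    by rewrite ltnNge; apply/negP => le; move: mw; rewrite piece_default.
  have [ws [tE /(pairwiseP [::]) fd cov]] : exists ws, [/\ tup t = map wcode ws,
      pairwise (formally_disjoint nu) ws &
      [set: T] `<=` \bigcup_(w in [set` ws]) ideal_cover nu w].
    by apply: tupP; left; exact: leq_trans jlt.
  move: ni mw ilt jlt; rewrite !(piece_nth _ ws)// tE size_map => ni mw ilt jlt.
  move: ij; rewrite neq_ltn => /orP[ij|ji].
    suff : set0 y by [].
    by rewrite -(formally_disjoint_alpha (fd i j ilt jlt ij) ni mw).
  suff : set0 y by [].
  by rewrite -(formally_disjoint_alpha (fd j i jlt ilt ji) mw ni).
have sT : sig_cover nu (fun _ _ => [set: T]).
  have sF := sig1_finc hX.
  (* A positive [p t] guarantees that the tuple covers the space; a blank entry would meet the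
     second clause vacuously. *)
  have s : sig2 (fun _ _ v => exists t, 0 < p t /\ forall j, j < size (tup t) ->
      forall n, n \in piece t j -> exists m, m \in word v /\ finc nu n m).
    by rewrite /piece /tup; effective.
  apply: sig1_ext s => _ z; set v := pr2 z; split=> [[t [pt tv]] y _|Tv].
    have [|ws [tE fd cov]] := tupP t; first by right.
    have [w /= /(nthP [::])[j jlt <-] [n nw ny]] := cov y I.
    have [||m [mv nm]] := tv j _ n; first by rewrite tE size_map.
      by rewrite (piece_nth _ ws).
    by exists m => //; exact: finc_sub nm _ ny.
  (* The refined cover is trivial; the content is the fineness requirement of formal inclusion in a
     ball of [v]. *)
  have [||x|ws [fd cov _ wsP]] := @disjoint_refinement 1 (fun=> [set: T])
    (fun n => exists m, m \in word v /\ finc nu n m) cT dimT.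
  - by move=> _; exact: openT.
  - by move=> x _; exists ord0.
  - have [m /= mv mx] := Tv x I.
    by apply: fine_atS (fine_at_finc mx) => n nm; exists m.
  have [t [pt tE]] := tup_ex ws fd cov.
  exists t; split=> // j; rewrite tE size_map => jlt n.
  by rewrite (piece_nth _ ws)//; apply: wsP; exact: mem_nth.
exists b; split; last first.
  split=> //; last exact: (@sig_cover_sub _ _ nu (fun _ _ => [set: T])).
  move=> _ z; apply: subclosed_compact cT _ => //.
  have [A _ bA] := bC; rewrite -openC (bA no_oracle z).
  exact: open_bigcup_alpha.
apply: basis_intro => [_ [z _ <-]|x O Oo Ox]; first exact: open_ideal_cover.
have x1 : closed [set x].
  by apply: compact_closed; [exact: metric_hausdorff|exact: compact_set1].
(* Refining the cover by [O] and the complement of [x] forces the piece containing [x] into [O]. *)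
have [|||ws [fd cov wO _]] := @disjoint_refinement 2
    (fun i => if i == ord0 then O else ~` [set x]) (fun=> True) cT dimT.
- by move=> i; case: ifP => // _; exact: closed_openC.
- move=> y _; have [->|yx] := eqVneq y x; first by exists ord0.
  by exists ord_max => //=; apply/eqP.
- by move=> y; exists 1%R.
have [w ww wx] := cov x I; have [t [_ tE]] := tup_ex ws fd cov.
have /(nthP [::])[j jlt jw] : w \in ws := ww.
exists (b (pairN t j)); split; first by exists (pairN t j).
- by rewrite /b !prE (piece_nth _ ws)// jw.
- rewrite /b !prE (piece_nth _ ws)// jw.
  by have [i] := wO w ww; case: ifP => // _ /(_ _ wx) /(_ erefl).
Qed.

End Disjoint.

(** * Effective partitions into small clopen sets *)

Section DhatComputable.
Context {R : realType} {T : metricType R} (nu : nat -> T).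
Hypothesis hX : computable_metric_space nu.

(** The empty set at index 0 pads enumerations at blank stages, and lists that have to be
    nonempty. *)
Definition with_empty (b : nat -> set T) (c : nat) : set T :=
  if c is a.+1 then b a else set0.

Lemma sig_KO_with_empty b : sig_KO nu (fun _ => b) ->
  sig_KO nu (fun _ => with_empty b).
Proof.
move=> [bc [A sA bA] [B sB bB] sK]; split.
- by move=> p [|c] /=; [exact: compact0|exact: (bc p)].
- exists (fun p c n => 0 < c /\ A p c.-1 n); first by effective.
  move=> p [|c] /=; last by rewrite (bA p); apply/seteqP; split=> y [n];
    [exists n|case=> _; exists n].
  by apply/esym; rewrite -subset0 => y [n []].
- exists (fun p c n => c = 0 \/ B p c.-1 n); first by effective.
  move=> p [|c] /=; last by rewrite (bB p); apply/seteqP; split=> y [n];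
    [exists n => //; right|case=> //; exists n].
  rewrite setC0 -(bigcup_alphaT hX); apply/seteqP; split=> y [n _ ny];
    by exists n => //; left.
- pose cov (p : baire) c v := b c `<=` ideal_cover nu (word v).
  have sCov : sig2 cov := sK.
  have s : sig2 (fun p c v => c = 0 \/ cov p c.-1 v) by effective.
  apply: sig1_ext s => p z; case: (pr1 z) => [|c].
    by split=> _; [exact: sub0set|left].
  by split=> [[]|] //; right.
Qed.

(** The decidable premise is the conclusion with denominators cleared. *)
Lemma ideal_radius_lt m n :
  2 * (pr1 (pr2 m)).+1 * n.+1 < (pr2 (pr2 m)).+1 ->
  (2 * ideal_radius m < n.+1%:R^-1 :> R)%R.
Proof.
rewrite -(ltr_nat R) !natrM /ideal_radius /nuQpos rmorphM /= fmorphV /= !rmorph_nat.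
move=> h; rewrite -[ltRHS]mul1r ltr_pdivlMr ?ltr0n// mulrA mulrAC.
by rewrite ltr_pdivrMr ?ltr0n// mul1r.
Qed.

Lemma fine_at_small x n :
  fine_at nu x (fun m => 2 * (pr1 (pr2 m)).+1 * n.+1 < (pr2 (pr2 m)).+1).
Proof.
exists (2 * n.+1%:R)^-1%R; first by rewrite invr_gt0 mulr_gt0 ?ltr0n.
move=> m _; rewrite -(ltr_nat R) !natrM /ideal_radius /nuQpos.
rewrite rmorphM /= fmorphV /= !rmorph_nat.
rewrite ltr_pdivrMr ?ltr0n// mulrC ltr_pdivlMr ?mulr_gt0 ?ltr0n//.
by move=> h; rewrite mulrAC mulrC.
Qed.

Lemma Dhat_computable_of_KO_basis b : KO_basis nu b -> Dhat_computable nu.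
Proof.
move=> [bB /sig_KO_with_empty]; set b' := with_empty b.
move=> [b'c [A sA b'A] b'C b'K].
have b'O : sig_open nu (fun _ => b') by exists A.
pose cov (p : baire) c v := b' c `<=` ideal_cover nu (word v).
have sCov : sig2 cov := b'K.
pose inb (p : baire) c n := b' c `<=` alpha nu n.
have sInb : sig2 inb.
  have s : sig2 (fun p c n => cov p c (2 ^ n)) by effective.
  apply: sig1_ext s => p z; rewrite /cov -[2 ^ _]muln1.
  rewrite -(wcode_cons _ [::]) /wcode CodeSeq.codeK /ideal_cover.
  by rewrite set_cons1 bigcup_set1.
(* The left half of any oracle names an open set, so the whole construction is total in [p]. *)
pose U p := \bigcup_(i in [set i | 0 < unpair_l p i]) alpha nu (unpair_l p i).-1.
(* Lying inside a single listed ball is semidecidable, and the elements with this property still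
   exhaust [U p]. *)
pose sub p c := c = 0 \/ exists i, 0 < unpair_l p i /\ inb p c (unpair_l p i).-1.
have sSub : sig1 sub by rewrite /sub /unpair_l; effective.
have subU p c : sub p c -> b' c `<=` U p.
  by move=> [->//|[i [pi bi]]] y /bi yi; exists i.
pose small p n c := c = 0 \/ exists m, inb p c m /\
  2 * (pr1 (pr2 m)).+1 * n.+1 < (pr2 (pr2 m)).+1.
have sSmall : sig1 (fun p z => small p (pr1 z) (pr2 z)).
  by rewrite /small; effective.
have smallP p n c : small p n c -> forall V, V `<=` b' c ->
    (diam V < (n.+1%:R^-1)%:E)%E.
  move=> [->|[m [cm mn]]] V Vc.
    (* [V] is empty here, and any small enough ball, such as one around [nu 0], bounds its
       diameter. *)
    have [m [_ mn]] := fine_at_ex hX (fine_at_small (nu 0) n).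
    by apply: (@diam_alpha _ _ nu) (ideal_radius_lt mn) => y /Vc.
  by apply: (@diam_alpha _ _ nu) (ideal_radius_lt mn) => y /Vc /cm.
have sub_small p n x : U p x -> exists c, [/\ sub p c, small p n c & b' c x].
  move=> [i pi ix].
  have [m [mx [mi mn]]] := fine_at_ex hX (fine_atI (fine_at_finc ix) (fine_at_small x n)).
  have [_ [[a _ <-] ax am]] := basisP bB (open_alpha nu m) mx.
  exists a.+1; split=> //; right; last by exists m.
  exists i; split; first exact: pi.
  exact: subset_trans am (finc_sub mi).
have [G cG subG] := sSub.
pose e p n := if G p (pr1 n) (pr2 n) then pr1 n else 0.
have ce : computable e.
  by apply: (@comp_if (fun p n => G p (pr1 n) (pr2 n)) (fun _ n => pr1 n)
    (fun _ _ => 0)); effective.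
have esub p n : b' (e p n) `<=` U p.
  rewrite /e; case: ifP => [Gn|_ y []].
  by apply: subU; apply/subG; exists (pr2 n).
have eU p : U p `<=` \bigcup_n b' (e p n).
  move=> y /(sub_small p 0)[c [/subG[k Gk] _ cy]].
  by exists (pairN c k) => //; rewrite /e !prE Gk.
have [L cL LP] : exists2 L, computable L & forall p n,
    [/\ 0 < size (word (L p n)),
      forall c, c \in word (L p n) -> sub p c /\ small p n c &
      b' (e p n) `<=` \bigcup_(c in [set` word (L p n)]) b' c].
  (* That the list covers [b' (e p n)] is witnessed by a word [v] of balls covering this set, each
     of them listed for some [c] in the list. *)
  pose S p n l := 0 < size (word l) /\
    (forall c, c \in word l -> sub p c /\ small p n c) /\
    exists v, cov p (e p n) v /\
      forall a, a \in word v -> exists c, c \in word l /\ A p c a.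
  have sS : sig1 (fun p z => S p (pr1 z) (pr2 z)) by rewrite /S; effective.
  have [p n|L cL LS] := sig1_choice sS; last first.
    exists L => // p n; have [l0 [lP [v [nv vl]]]] := LS p n; split=> //.
    move=> y /nv[a /= /vl[c [cl Aca]] ay]; exists c => //.
    by rewrite (b'A p); exists a.
  have [||w [wP nw]] := @compact_nat_cover _ _
    [set c | sub p c /\ small p n c] b' (b'c p (e p n)).
  - by move=> c _; rewrite (b'A p); exact: open_bigcup_alpha.
  - by move=> y /esub/(sub_small p n)[c [? ? ?]]; exists c.
  have [|v [vP nv]] := @compact_ideal _ _ nu _
    [set a | exists c, c \in w /\ A p c a] (b'c p (e p n)).
    move=> y /nw[c /= cw]; rewrite (b'A p) => -[a Aca ay].
    by exists a => //; exists c.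
  (* The leading 0 contributes the empty set and makes the list nonempty, so that [r] is
     positive. *)
  exists (wcode (0 :: w)); rewrite /S /wcode CodeSeq.codeK; split=> //; split.
    move=> c; rewrite in_cons => /predU1P[->|/wP//].
    by split; left.
  exists (wcode v); rewrite /cov /wcode CodeSeq.codeK; split=> // a /vP[c [cw Aca]].
  by exists c; rewrite in_cons cw orbT.
pose r p n := size (word (L p n)).
have cr : computable r by rewrite /r; effective.
have r0 p n : 0 < r p n by have [] := LP p n.
(* The position at which the n-th list begins in the concatenation. *)
pose start p n := \sum_(i < n) r p i.
have startS p n : start p n.+1 = start p n + r p n by rewrite /start big_ord_recr.
have cstart : computable start.
  have c2 : computable2 (fun p x n => start p n).
    apply: (@comp_prim (fun p x n => start p n) (fun _ _ => 0)
      (fun p x n s => s + r p n)) => [p x|p x n| |].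
    - by rewrite /start big_ord0.
    - exact: startS.
    - exact: comp_const.
    - by effective.
  exact: (@comp_app2 (fun p _ n => start p n) _ _ c2 comp_id comp_id).
have start_mono p m n : m <= n -> start p m <= start p n.
  elim: n => [|n IHn]; first by rewrite leqn0 => /eqP->.
  by rewrite leq_eqVlt => /predU1P[->//|/IHn]; rewrite startS; lia.
have start_lt p n j m : j < r p n -> n < m -> start p n + j < start p m.
  by move=> jr /(start_mono p); rewrite startS; lia.
(* Recovers the list number and the offset from a position [i]. When a list is exhausted, the next
   one is nonempty and provides offset 0. *)
have [pos cpos posP] : exists2 pos, computable pos & forall p i,
    start p (pr1 (pos p i)) + pr2 (pos p i) = i /\
    pr2 (pos p i) < r p (pr1 (pos p i)).
  apply: (@sig1_choice (fun p i z => start p (pr1 z) + pr2 z = i /\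
    pr2 z < r p (pr1 z))) => [|p i]; first by effective.
  elim: i => [|i [z [zi zr]]].
    by exists (pairN 0 0); rewrite !prE /start big_ord0; split.
  have [lt|ge] := ltnP (pr2 z).+1 (r p (pr1 z)).
    by exists (pairN (pr1 z) (pr2 z).+1); rewrite !prE addnS zi.
  by exists (pairN (pr1 z).+1 0); rewrite !prE startS; split=> //; lia.
pose c p i := nth 0 (word (L p (pr1 (pos p i)))) (pr2 (pos p i)).
have cc : computable c by rewrite /c; effective.
have c_start p n j : j < r p n -> c p (start p n + j) = nth 0 (word (L p n)) j.
  move=> jr; rewrite /c; have [] := posP p (start p n + j).
  move: (pr1 _) (pr2 _) => n' j' en j'r.
  case: (ltngtP n n') => [/(start_lt p n j n' jr)|/(start_lt p n' j' n j'r)|nn'].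
  - by lia.
  - by lia.
  - by move: en; rewrite nn' => /addnI->.
have csub p i : sub p (c p i).
  have [_ jr] := posP p i; have [_ h _] := LP p (pr1 (pos p i)).
  by have [] := h _ (mem_nth 0 jr).
pose W p := seqDU (fun i => b' (c p i)).
(* An intersection with finitely many complements is the shape that [sig_open_bigcap] handles. *)
have WE : W = fun p i =>
    b' (c p i) `&` \bigcap_(j in [set j | j < i]) ~` b' (c p j).
  apply/funext => p; apply/funext => i.
  by rewrite /W /seqDU -(bigcup_mkord i (fun j => b' (c p j))) setDE setC_bigcup.
have cpr2 : computable (fun p z => c p (pr2 z)) by effective.
have WO : sig_open nu W.
  rewrite WE; apply: (@sig_open_bigcap _ _ nu hX (fun p i => b' (c p i))
    (fun p _ j => ~` b' (c p j)) (fun _ i => i)).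
  - exact: sig_open_app b'O cc.
  - exact: sig_open_app b'C cpr2.
  - exact: comp_id.
have WC : sig_open nu (fun p i => ~` W p i).
  have -> : (fun p i => ~` W p i) = fun p i => ~` b' (c p i) `|`
      \bigcup_(j in [set j | j < i]) b' (c p j).
    apply/funext => p; apply/funext => i.
    by rewrite WE setCI setC_bigcap; under eq_bigcupr do rewrite setCK.
  apply: sig_openU; first exact: sig_open_app b'C cc.
  apply: (@sig_open_bigcup _ _ nu (fun p i j => j < i) (fun p _ j => b' (c p j))).
    by effective.
  exact: sig_open_app b'O cpr2.
have Wsub p i : W p i `<=` b' (c p i) by rewrite WE; exact: subIsetl.
have WK : sig_cover nu W.
  apply: (@sig_cover_sub _ _ nu (fun p i => b' (c p i))) => //.
  - by move=> p i; exact: (b'c p).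
  - exact: sig_cover_app b'K cc.
have WU p : \bigcup_i W p i = U p.
  rewrite -seqDU_bigcup_eq; apply/seteqP; split=> y.
    by move=> [i _]; exact: subU (csub p i) y.
  move=> /eU[n _]; have [_ _ /[apply]] := LP p n.
  move=> [_ /(nthP 0)[j jr <-] jy]; exists (start p n + j) => //.
  by rewrite c_start.
have [s cs sP] : exists2 s, computable s & forall p i,
    s p i < 2 /\ (W p i = set0 <-> s p i = 0).
  have [B sB WB] := WO.
  pose covW p i v := W p i `<=` ideal_cover nu (word v).
  have sCovW : sig1 (fun p z => covW p (pr1 z) (pr2 z)) := WK.
  have cov0 p i : covW p i 0 <-> W p i = set0.
    by rewrite /covW /ideal_cover word0 set_nil bigcup_set0 subset0.
  have B0 p i n : B p i n -> W p i <> set0.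
    rewrite WB => Bn /seteqP[+ _] => /(_ (nu (pr1 n))); apply.
    by exists n => //; exact: alpha_center.
  (* Both alternatives are semidecidable and one always holds: an empty set is covered by the empty
     word, of code 0, and a nonempty one has a listed ball, which contains its own centre. *)
  have [|p i|s cs sP] := @sig1_choice (fun p i s => (s = 0 /\ covW p i 0) \/
    (s = 1 /\ exists n, B p i n)); first by effective.
    have [W0|] := pselect (W p i = set0); first by exists 0; left; rewrite cov0.
    move/eqP/set0P => [y]; rewrite WB => -[n Bn _].
    by exists 1; right; split=> //; exists n.
  exists s => // p i; have [[-> /cov0 W0]|[-> [n /B0 W0]]] := sP p i; split=> //.
have [Q cQ QP] := sig_open_clopen_name WO WC.
(* The nesting follows the product representation of the triple. *)
pose out p := interleave (interleave (fun i => Q p (pr1 i) (pr2 i)) (r p)) (s p).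
have [d dP] : computable out.
  have c2 : computable2 (fun p (_ : nat) => out p).
    apply: (@comp2_interleave (fun p _ => interleave (fun i => Q p (pr1 i) (pr2 i)) (r p))
      (fun p _ => s p)); last by effective.
    by apply: (@comp2_interleave (fun p _ i => Q p (pr1 i) (pr2 i)) (fun p _ => r p));
      effective.
  exact: (@comp_app2 (fun p _ => out p) _ _ c2 comp_id comp_id).
exists d => p [V K] [/= pV _] VK; exists (out p); split; first exact: dP.
have {pV} VU : V = U p by [].
exists (W p, r p, s p); split; first split; rewrite /= ?interleaveE.
- split; rewrite /= ?interleaveE.
    move=> i /=; have := QP p i; congr (delta_Delta _ _ _).
    by apply/funext => j; rewrite /untuple !prE.
  by split=> // n; exact: r0.
- by split=> // n; have [] := sP p n.
split=> //.
- exact: trivIset_seqDU.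
- by rewrite WU.
- by move=> i; have [] := sP p i.
- move=> n j jr; have sm : small p n (c p (start p n + j)).
    by rewrite c_start//; have [_ /(_ _ (mem_nth 0 jr))[]] := LP p n.
  exact: smallP sm _ (Wsub p _).
Qed.

Lemma KO_basis_cond3 b : KO_basis nu b -> Dhat_computable nu /\
  exists gamma : nat -> set T * set T,
    [/\ computable_fun rep_nat (rep_prod (delta_Sigma nu) (delta_cover nu)) gamma,
        basis (range (fun a => (gamma a).1)) &
        forall a, (gamma a).1 `<=` (gamma a).2].
Proof.
move=> bKO; split; first exact: Dhat_computable_of_KO_basis bKO.
(* A compact open set serves as its own compact superset. *)
have [bB [bc bO _ bK]] := bKO; exists (fun a => (b a, b a)).
split=> //; last by move=> a /=; exact: subset_refl.
have [P cP PP] := sig_open_name bO.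
have [Q cQ QP] := sig_cover_name hX bc bK.
apply: (@name_computable_fun_nat _ _ _ (fun p x => interleave (P p x) (Q p x))).
  exact: comp2_interleave.
by move=> p x; split; rewrite /= interleaveE.
Qed.

End DhatComputable.

(** * Combining the implications *)

Theorem proposition7p3 (R : realType) (T : metricType R) (nu : nat -> T)
    (hX : computable_metric_space nu) :
  let cond1 := computable_point (delta_disj_cover' nu) [set: T] in
  let cond2 :=
    exists (B : set (set T)) (b : nat -> set T),
      [/\ basis B, computable_fun rep_nat (delta_KO nu) b,
          range b = B & B `<=` KO] in
  let cond3 :=
    Dhat_computable nu /\
    exists gamma : nat -> set T * set T,
      [/\ computable_fun rep_nat
            (rep_prod (delta_Sigma nu) (delta_cover nu)) gamma,
          basis (range (fun a => (gamma a).1)) &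
          forall a, (gamma a).1 `<=` (gamma a).2] in
  let cond4 :=
    exists (b : nat -> set T) (S : nat -> nat -> Prop),
      [/\ computable_fun rep_nat (delta_Delta nu) b,
          ce_rel S, refined_inclusion nu b S & basis (range b)] in
  [/\ cond1 -> cond2, cond2 <-> cond3 & cond3 -> cond4].
Proof.
move=> cond1 cond2 cond3 cond4.
have KO_cond2 : (exists b, KO_basis nu b) -> cond2.
  move=> [b [bB bKO]]; exists (range b), b; split=> //.
    by apply/(computable_KO hX).
  by move=> _ [n _ <-]; exact: (sig_KO_KO no_oracle n bKO).
have cond2_KO : cond2 -> exists b, KO_basis nu b.
  move=> [B [b [bB cb bE _]]]; exists b; split; last exact/(computable_KO hX).
  by rewrite bE.
have cond3_KO : cond3 -> exists b, KO_basis nu b.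
  by move=> [cD [gamma [cg gB gsub]]]; exact: cond3_KO_basis cD cg gB gsub.
split.
- by move/(cond1_KO_basis hX)/KO_cond2.
- by split=> [/cond2_KO[b /(KO_basis_cond3 hX)]|/cond3_KO/KO_cond2].
- by move/cond3_KO => [b bKO]; exists b; exact: KO_basis_cond4 bKO.
Qed.
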